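(* The Efficient Domination (ED) problem can be solved robustly in linear time $O(n+m)$ on $2P_2$-free graphs, where $n$ and $m$ denote the numbers of vertices and edges of the input graph.
   Context: All graphs are finite, undirected and simple. A vertex dominates itself and all its neighbors. A vertex set $D$ of a graph $G$ is an efficient dominating set (e.d.) if every vertex of $G$ is dominated by exactly one vertex of $D$. The ED problem asks whether a given graph has an e.d. (and, when one exists, to find one). $2P_2$ denotes the disjoint union of two copies of the path on two vertices; a graph is $2P_2$-free if it contains no induced subgraph isomorphic to $2P_2$. An algorithm for a problem on a graph class $\mathcal{C}$ is robust if it accepts an arbitrary graph as input and either solves the problem correctly or correctly determines that the input graph is not in $\mathcal{C}$ (so membership in $\mathcal{C}$ need not be recognized beforehand). *)

(* Defs.v *)
From mathcomp Require Import all_boot.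
Set Implicit Arguments. Unset Strict Implicit. Unset Printing Implicit Defensive.

Definition simple_graph (n : nat) (e : rel 'I_n) : Prop :=
  symmetric e /\ irreflexive e.

Definition dominates (n : nat) (e : rel 'I_n) (u v : 'I_n) : bool :=
  (u == v) || e u v.

Definition efficient_dominating (n : nat) (e : rel 'I_n) (D : {set 'I_n}) : Prop :=
  forall v : 'I_n, #|[set u in D | dominates e u v]| = 1.

Definition induced_2P2 (n : nat) (e : rel 'I_n) (a b c d : 'I_n) : Prop :=
  [/\ e a b, e c d & [/\ a != c, a != d, b != c & b != d]] /\
  [/\ ~~ e a c, ~~ e a d, ~~ e b c & ~~ e b d].

Definition twoP2_free (n : nat) (e : rel 'I_n) : Prop :=
  ~ exists a b c d, induced_2P2 e a b c d.

Definition num_edges (n : nat) (e : rel 'I_n) : nat :=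
  #|[set p : 'I_n * 'I_n | (p.1 < p.2)%N && e p.1 p.2]|.

Definition adj_lists (n : nat) (e : rel 'I_n) (adj : 'I_n -> seq 'I_n) : Prop :=
  forall i : 'I_n, uniq (adj i) /\ (forall j, (j \in adj i) = e i j).

Inductive instr : Type :=
| IConst of nat & nat
| IAdd   of nat & nat & nat
| ISub   of nat & nat & nat
| ILoad  of nat & nat
| IStore of nat & nat
| IJz    of nat & nat
| IHalt.

Record state : Type := State { ram_pc : nat; ram_reg : nat -> nat; ram_mem : nat -> nat }.

Definition upd (f : nat -> nat) (a v : nat) : nat -> nat :=
  fun x => if x == a then v else f x.

Definition cur_instr (prog : seq instr) (s : state) : instr :=
  nth IHalt prog (ram_pc s).

(* one step; a halted machine (current instruction IHalt, including a
   program counter outside the program) stays put *)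
Definition step (prog : seq instr) (s : state) : state :=
  let R := ram_reg s in let M := ram_mem s in let p := ram_pc s in
  match cur_instr prog s with
  | IConst r k => State p.+1 (upd R r k) M
  | IAdd r a b => State p.+1 (upd R r (R a + R b)) M
  | ISub r a b => State p.+1 (upd R r (R a - R b)) M
  | ILoad r a => State p.+1 (upd R r (M (R a))) M
  | IStore a b => State p.+1 R (upd M (R a) (R b))
  | IJz r l => State (if R r == 0 then l else p.+1) R M
  | IHalt => s
  end.

Definition run (prog : seq instr) (k : nat) (s : state) : state :=
  iter k (step prog) s.

Definition halted (prog : seq instr) (s : state) : bool :=
  if cur_instr prog s is IHalt then true else false.

Definition encode (n : nat) (e : rel 'I_n) (adj : 'I_n -> seq 'I_n) : seq nat :=
  n :: num_edges e ::
    flatten [seq size (adj i) :: map val (adj i) | i <- enum 'I_n].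

Definition init_state (input : seq nat) : state :=
  State 0 (fun _ => 0) (fun a => nth 0 input a).

Definition correct_output (n : nat) (e : rel 'I_n) (M : nat -> nat) : Prop :=
  (M 0 = 0 /\ efficient_dominating e [set v : 'I_n | M (val v).+1 == 1])
  \/ (M 0 = 1 /\ ~ exists D : {set 'I_n}, efficient_dominating e D)
  \/ (M 0 = 2 /\ ~ twoP2_free e).

(* Main.v *)
Require Import Defs.
From mathcomp Require Import all_boot zify.
Set Implicit Arguments. Unset Strict Implicit. Unset Printing Implicit Defensive.

(* Let v be a vertex of minimum degree among the non-isolated ones, and let D
   consist of v and of the vertices at distance at least 3 from v.  An e.d.
   containing v is a subset of D.  If D is an e.d., output it; if D is not
   independent, an edge inside D and an edge at v form a 2P2; if D is independent
   but not an e.d., then no e.d. contains v.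

   In the last case an e.d. must contain some u in N(v).  For each such u, look for
   a non-isolated vertex a outside N(u) + N(v).  If a exists and has a neighbour b
   outside N(u) + N(v), then uv and ab form a 2P2; if a has no such neighbour, the
   minimality of deg(v) shows that u belongs to no e.d.  If a does not exist, then
   either u dominates all non-isolated vertices and, with the isolated ones, forms
   an e.d., or u belongs to no e.d.  With n' non-isolated vertices the loop over u
   costs O(deg(v) n') = O(m).

   The machine program is obtained from a small language of counting loops, whose
   total evaluation function is simulated by the compiled code. *)

(** * Efficient domination and induced 2P2 *)

Section Graph.

Variables (n : nat) (al : nat -> seq nat).

(** Vertices are plain naturals, as in the machine memory. Symmetry and the bound together force
    [al x] to be empty for [x] outside the graph. *)
Definition adjacency : Prop :=
  [/\ forall x y, y \in al x -> y < n,
      forall x y, (y \in al x) = (x \in al y),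
      forall x, x \notin al x
    & forall x, uniq (al x)].

(** Splitting off [x] itself gives the closed-neighbourhood count in the form in which the machine
    accumulates it. *)
Definition dcount (D : pred nat) (x : nat) : nat := D x + count D (al x).

Definition ed (D : pred nat) : Prop := forall x, x < n -> dcount D x = 1.

(* That the four vertices are distinct follows from the non-adjacencies. *)
Definition has2P2 : Prop := exists a b c d,
  [/\ b \in al a, d \in al c
    & [/\ c \notin al a, d \notin al a, c \notin al b & d \notin al b]].

Definition dom (u x : nat) : bool := (u == x) || (u \in al x).

Definition min_degree (v : nat) : Prop := forall w, w < n -> al w != [::] ->
  al v != [::] /\ size (al v) <= size (al w).

(* [w] is [v] or at distance at least 3 from [v]. *)
Definition far (v w : nat) : bool :=
  (w == v) || (w \notin al v) && all (fun x => x \notin al v) (al w).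

Definition covered (u v x : nat) : bool := (x \in al v) || (x \in al u).

Definition dominating_vertex (u : nat) : Prop :=
  forall a, a < n -> al a != [::] -> a = u \/ a \in al u.

Hypothesis Hal : adjacency.

Let al_lt x y : y \in al x -> y < n. Proof. by case: Hal => H _ _ _; apply: H. Qed.
Let al_sym x y : (y \in al x) = (x \in al y). Proof. by case: Hal. Qed.
Let al_irr x : x \notin al x. Proof. by case: Hal. Qed.
Let al_uniq x : uniq (al x). Proof. by case: Hal. Qed.

Lemma dcount_ex D x : dcount D x != 0 -> exists2 u, D u & dom u x.
Proof.
rewrite /dcount; case Dx: (D x) => /=; first by exists x; rewrite // /dom eqxx.
rewrite add0n -lt0n -has_count => /hasP[u ux Du].
by exists u; rewrite // /dom ux orbT.
Qed.

Lemma dcount_uniq D x u w :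
  dcount D x = 1 -> D u -> D w -> dom u x -> dom w x -> u = w.
Proof.
have two y z : y \in al x -> z \in al x -> D y -> D z -> y <> z -> 1 < count D (al x).
  move=> yx zx Dy Dz yz.
  rewrite -size_filter; apply: (@uniq_leq_size _ [:: y; z]).
    by rewrite /= inE andbT; apply/eqP.
  by move=> t; rewrite !inE mem_filter => /orP[]/eqP->; rewrite ?Dy ?Dz.
have one y : y \in al x -> D y -> 0 < count D (al x).
  by move=> yx Dy; rewrite -has_count; apply/hasP; exists y.
rewrite /dcount => f1 Du Dw /orP[/eqP ux|ux] /orP[/eqP wx|wx].
- by rewrite ux wx.
- by move: f1 (one _ wx Dw); rewrite -ux Du; lia.
- by move: f1 (one _ ux Du); rewrite -wx Dw; lia.
- by case: (u =P w) => // uw; move: (two _ _ ux wx Du Dw uw) f1; lia.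
Qed.

Lemma dcount_neq1 (D : pred nat) w x : D w -> D x -> x \in al w -> dcount D w != 1.
Proof.
move=> Dw Dx xw; apply/eqP => /dcount_uniq/(_ Dw Dx).
by rewrite /dom eqxx xw orbT => /(_ isT isT) wx; move: (al_irr w); rewrite {1}wx xw.
Qed.

(** Two members of an e.d. at distance 1 or 2 would both dominate one vertex: [v] itself or a common
    neighbour. *)
Lemma ed_far X v w : ed X -> X v -> w < n -> X w -> far v w.
Proof.
move=> eX Xv wn Xw; rewrite /far; case: eqP => //= /eqP wv.
have nwv : w \notin al v.
  apply/negP => wv'; move/negP: wv; apply; apply/eqP; apply: (dcount_uniq (x := v) _ Xw Xv).
  - by apply: eX; apply: (al_lt (x := w)); rewrite al_sym.
  - by rewrite /dom wv' orbT.
  - by rewrite /dom eqxx.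
rewrite nwv; apply/allP => x xw; apply/negP => xv; move/negP: wv; apply; apply/eqP.
apply: (dcount_uniq (x := x) _ Xw Xv); first by apply: eX; apply: al_lt xw.
  by rewrite /dom al_sym xw orbT.
by rewrite /dom al_sym xv orbT.
Qed.

(** The hypothesis makes the far set independent. A far vertex outside [X] would have a neighbour in
    [X], which is far as well, against independence; so [X] and the far set coincide. *)
Lemma ed_far_unique v X : (forall w, w < n -> far v w -> dcount (far v) w = 1) ->
  ed X -> X v -> ed (far v).
Proof.
move=> ind eX Xv.
have same w : w < n -> far v w = X w.
  move=> wn; apply/idP/idP => [fw|]; last exact: ed_far.
  have [|u Xu /orP[/eqP<-//|uw]] := @dcount_ex X w; first by rewrite eX.
  have /(ed_far eX Xv)/(_ Xu) fu := al_lt uw.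
  by have := dcount_neq1 fw fu uw; rewrite ind.
move=> x xn; rewrite /dcount same // (@eq_in_count _ _ X); first exact: eX.
by move=> y /al_lt; apply: same.
Qed.

(* [w] has a neighbour [x] that is also far from [v]; pair the edge [w x] with
   any edge at [v]. *)
Lemma far_adjacent_2P2 v w : min_degree v -> w < n -> far v w ->
  dcount (far v) w <> 1 -> has2P2.
Proof.
move=> mv wn fw; rewrite /dcount fw => c1; have : has (far v) (al w) by rewrite has_count; move: c1 => /=; lia.
case/hasP => x xw fx.
have wv : w != v.
  apply/eqP => wv; move: fx; rewrite /far -wv xw /= orbF => /eqP xw'.
  by move: (al_irr w); rewrite -{1}xw' xw.
have xv : x != v.
  apply/eqP => xv; move: fw; rewrite /far -xv [w \in _]al_sym xw /= orbF => /eqP xw'.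
  by move: (al_irr w); rewrite {1}xw' xw.
move: fw fx; rewrite /far (negPf wv) (negPf xv) /= => /andP[nwv /allP aw] /andP[nxv /allP ax].
(* Since [w] is not isolated, [min_degree] provides [v] with a neighbour [y], hence the second
   edge. *)
have [|av _] := mv w wn; first by case: (al w) xw.
case E: (al v) av => [//|y s] _.
have yv : y \in al v by rewrite E mem_head.
exists v, y, w, x; split=> //; split=> //.
  by rewrite al_sym; apply/negP => /aw; rewrite yv.
by rewrite al_sym; apply/negP => /ax; rewrite yv.
Qed.

Lemma uncovered_edge_2P2 u v a b : u \in al v -> ~~ covered u v a -> b \in al a ->
  ~~ covered u v b -> has2P2.
Proof.
rewrite /covered !negb_or => uv /andP[av au] ba /andP[bv bu].
by exists v, u, a, b.
Qed.

(* An uncovered [a] is dominated by some [d <> u].  Either [d] is an uncovered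
   neighbour of [a], or [d = a]; then [N(a)] misses [u] and so, having at least
   [|N(v)|] elements, cannot be contained in [N(v)]. *)
Lemma uncovered_not_ed X u v a : min_degree v -> u \in al v -> a < n -> al a != [::] ->
  ~~ covered u v a -> all (covered u v) (al a) -> ed X -> ~ X u.
Proof.
move=> mv uv an a0 nca /allP ca eX Xu.
have vu : v \in al u by rewrite al_sym.
have un := al_lt uv; have vn := al_lt vu.
have only d x : d < n -> x < n -> X d -> dom d x -> dom u x -> d = u.
  by move=> dn xn Xd; apply: (dcount_uniq (eX _ xn)).
have [|d Xd da] := @dcount_ex X a; first by rewrite eX.
have dn : d < n by case/orP: da => [/eqP->//|/al_lt].
have du : d <> u.
  move=> du; move: (nca) da; rewrite /covered /dom du negb_or => /andP[_ au].
  rewrite al_sym (negPf au) orbF => /eqP ua.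
  by move: au nca; rewrite /covered -ua uv.
(* A covered [d] would dominate [v] or [u], each already dominated by [u]. *)
have ndu : ~~ covered u v d.
  apply/negP => /orP[dv|du'].
    apply/du/(only d v) => //; first by rewrite /dom dv orbT.
    by rewrite /dom uv orbT.
  apply/du/(only d u) => //; first by rewrite /dom du' orbT.
  by rewrite /dom eqxx.
case/orP: da => [/eqP da|da]; last by rewrite (ca _ da) in ndu.
have sub : {subset al a <= rem u (al v)}.
  move=> b ba; rewrite mem_rem_uniq // inE; apply/andP; split.
    by apply: contra nca => /eqP <-; rewrite /covered [a \in al b]al_sym ba orbT.
  (* A neighbour [b] of [a] lying in N(u) would be dominated by both [d = a] and [u]. *)
  case/orP: (ca _ ba) => // bu; case: du; apply: (only d b) => //; first exact: al_lt ba.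
    by rewrite /dom da al_sym ba orbT.
  by rewrite /dom al_sym bu orbT.
have := uniq_leq_size (al_uniq a) sub; rewrite size_rem //.
have [_] := mv a an a0; move: uv; case: (al v) => //= z s _; lia.
Qed.

(** The member [d] of [X] dominating a non-isolated [a] is itself non-isolated, hence covered. So it
    dominates [v] or [u], as [u] does, and therefore equals [u]. *)
Lemma all_covered_dominating X u v : u \in al v ->
  (forall a, a < n -> al a != [::] -> covered u v a) -> ed X -> X u ->
  dominating_vertex u.
Proof.
move=> uv cov eX Xu a an a0.
have vu : v \in al u by rewrite al_sym.
have un := al_lt uv; have vn := al_lt vu.
have [|d Xd da] := @dcount_ex X a; first by rewrite eX.
suff <- : d = u.
  by case/orP: da => [/eqP->|da]; [left|right; rewrite al_sym].
have dn : d < n by case/orP: da => [/eqP->//|/al_lt].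
have d0 : al d != [::].
  case/orP: da => [/eqP->//|]; rewrite al_sym; by case: (al d).
case/orP: (cov d dn d0) => [dv|du].
  apply: (dcount_uniq (eX v vn) Xd Xu); first by rewrite /dom dv orbT.
  by rewrite /dom uv orbT.
apply: (dcount_uniq (eX u un) Xd Xu); first by rewrite /dom du orbT.
by rewrite /dom eqxx.
Qed.

Lemma dominating_vertex_ed u : al u != [::] -> dominating_vertex u ->
  ed (fun w => (w == u) || (al w == [::])).
Proof.
move=> u0 du x xn; rewrite /dcount.
(* A neighbour of [x] is never isolated, so only [u] can be counted. *)
have cx : count (fun w => (w == u) || (al w == [::])) (al x) = (u \in al x).
  rewrite -count_uniq_mem //; apply: eq_in_count => y yx /=.
  by rewrite [al y == _]negbTE ?orbF //; move: yx; rewrite al_sym; case: (al y).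
rewrite cx; case: eqP => [->|xu] /=; first by rewrite (negPf (al_irr u)).
case: eqP => [->//|/eqP x0] /=.
by have [//|] := du x xn x0; rewrite al_sym => ->.
Qed.

End Graph.

(** * A loop language and its compilation *)

Record store : Type := Store { rg : nat -> nat; ar : nat -> nat -> nat }.

Definition setr (s : store) (r v : nat) : store := Store (upd (rg s) r v) (ar s).

Definition seta (s : store) (k i v : nat) : store :=
  Store (rg s) (fun k' => if k' == k then upd (ar s k) i v else ar s k').

Inductive cmd : Type :=
| CSkip
| CConst of nat & nat
| CMov of nat & nat
| CAdd of nat & nat & nat
| CSub of nat & nat & nat
| CLoad of nat & nat & nat
| CStore of nat & nat & nat
| CSeq of cmd & cmd
| CIf of nat & cmd & cmd
| CFor of nat & nat & cmd.

Fixpoint downto (f : nat -> store -> store) (n : nat) (s : store) : store :=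
  if n is m.+1 then downto f m (f m s) else s.

(* [CFor k h c] runs [c] with register [k] equal to [h - 1, ..., 1, 0]: counting
   down makes the loop test a comparison with zero, the only test of the machine. *)
Fixpoint eval (c : cmd) (s : store) : store :=
  match c with
  | CSkip => s
  | CConst r v => setr s r v
  | CMov r a => setr s r (rg s a)
  | CAdd r a b => setr s r (rg s a + rg s b)
  | CSub r a b => setr s r (rg s a - rg s b)
  | CLoad r k i => setr s r (ar s k (rg s i))
  | CStore k i r => seta s k (rg s i) (rg s r)
  | CSeq a b => eval b (eval a s)
  | CIf r a b => if rg s r == 0 then eval b s else eval a s
  | CFor k h b =>
      downto (fun m s => eval b (setr s k m)) (rg s h) (setr s k (rg s h))
  end.

(** An iteration costs three extra instructions: the test, the decrement and the jump back. The
    final 1 is the test that leaves the loop. *)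
Fixpoint time_downto (f : nat -> store -> store) (g : nat -> store -> nat)
    (n : nat) (s : store) : nat :=
  if n is m.+1 then 3 + g m s + time_downto f g m (f m s) else 1.

Fixpoint time (c : cmd) (s : store) : nat :=
  match c with
  | CSkip => 0
  | CLoad _ _ _ | CStore _ _ _ => 2
  | CSeq a b => time a s + time b (eval a s)
  | CIf r a b => if rg s r == 0 then 1 + time b s else 2 + time a s
  | CFor k h b =>
      1 + time_downto (fun m s => eval b (setr s k m)) (fun m s => time b (setr s k m))
            (rg s h) (setr s k (rg s h))
  | _ => 1
  end.

Fixpoint all_downto (f : nat -> store -> store) (g : nat -> store -> Prop)
    (n : nat) (s : store) : Prop :=
  if n is m.+1 then g m s /\ all_downto f g m (f m s) else True.

(** A syntactic over-approximation of the registers written, and likewise [awr] for arrays, so that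
    frame conditions on concrete commands are decided by computation. *)
Fixpoint wr (c : cmd) : seq nat :=
  match c with
  | CConst r _ | CMov r _ | CAdd r _ _ | CSub r _ _ | CLoad r _ _ => [:: r]
  | CSeq a b | CIf _ a b => wr a ++ wr b
  | CFor k _ b => k :: wr b
  | _ => [::]
  end.

Fixpoint awr (c : cmd) : seq nat :=
  match c with
  | CStore k _ _ => [:: k]
  | CSeq a b | CIf _ a b => awr a ++ awr b
  | CFor k _ b => awr b
  | _ => [::]
  end.

Lemma downto_ind (P : store -> Prop) f n s :
  (forall m s, P s -> P (f m s)) -> P s -> P (downto f n s).
Proof. by move=> Pf; elim: n s => //= n IH s Ps; apply/IH/Pf. Qed.

Lemma eval_rg c s r : r \notin wr c -> rg (eval c s) r = rg s r.
Proof.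
elim: c s => //=.
- by move=> q v s; rewrite inE /upd => /negPf->.
- by move=> q a s; rewrite inE /upd => /negPf->.
- by move=> q a b s; rewrite inE /upd => /negPf->.
- by move=> q a b s; rewrite inE /upd => /negPf->.
- by move=> q k i s; rewrite inE /upd => /negPf->.
- by move=> a IHa b IHb s; rewrite mem_cat negb_or => /andP[ra rb]; rewrite IHb ?IHa.
- move=> q a IHa b IHb s; rewrite mem_cat negb_or => /andP[ra rb].
  by case: ifP => _; rewrite ?IHb ?IHa.
- move=> k h b IH s; rewrite inE negb_or => /andP[rk rb].
  apply: (@downto_ind (fun s' => rg s' r = rg s r)) => [m s' <-|].
    by rewrite IH //= /upd (negPf rk).
  by rewrite /= /upd (negPf rk).
Qed.

Lemma eval_ar c s k : k \notin awr c -> ar (eval c s) k = ar s k.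
Proof.
elim: c s => //=.
- by move=> q i r s; rewrite inE => /negPf->.
- by move=> a IHa b IHb s; rewrite mem_cat negb_or => /andP[ra rb]; rewrite IHb ?IHa.
- move=> q a IHa b IHb s; rewrite mem_cat negb_or => /andP[ra rb].
  by case: ifP => _; rewrite ?IHb ?IHa.
- move=> q h b IH s kb; apply: (@downto_ind (fun s' => ar s' k = ar s k)) => // m s' <-.
  by rewrite IH.
Qed.

(** * Translation of the loop language into machine code *)

Definition narrays : nat := 7.

(** The machine decrements the loop counter where [eval] resets it; the two agree only if the body
    leaves the counter alone. *)
Fixpoint well_formed (c : cmd) : bool :=
  match c with
  | CLoad _ k _ | CStore k _ _ => k < narrays
  | CSeq a b | CIf _ a b => well_formed a && well_formed b
  | CFor k _ b => (k \notin wr b) && well_formed b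
  | _ => true
  end.

(* Machine registers: 0 holds 0, 1 is scratch, 2 holds 1, then come the base
   addresses of the arrays, then the registers of the source language. *)
Definition base_reg (k : nat) : nat := k + 3.
Definition user_reg (r : nat) : nat := r + (narrays + 3).

(** Jump targets are absolute, so the start address [p] is a parameter. As register 0 holds 0,
    [IJz 0] is an unconditional jump and adding register 0 is a copy. *)
Fixpoint compile (p : nat) (c : cmd) : seq instr :=
  match c with
  | CSkip => [::]
  | CConst r v => [:: IConst (user_reg r) v]
  | CMov r a => [:: IAdd (user_reg r) (user_reg a) 0]
  | CAdd r a b => [:: IAdd (user_reg r) (user_reg a) (user_reg b)]
  | CSub r a b => [:: ISub (user_reg r) (user_reg a) (user_reg b)]
  | CLoad r k i => [:: IAdd 1 (base_reg k) (user_reg i); ILoad (user_reg r) 1]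
  | CStore k i r => [:: IAdd 1 (base_reg k) (user_reg i); IStore 1 (user_reg r)]
  | CSeq a b => let ca := compile p a in ca ++ compile (p + size ca) b
  | CIf r a b =>
      let ca := compile p.+1 a in
      let q := p.+2 + size ca in
      let cb := compile q b in
      IJz (user_reg r) q :: ca ++ IJz 0 (q + size cb) :: cb
  | CFor k h b =>
      let cb := compile p.+3 b in
      [:: IAdd (user_reg k) (user_reg h) 0, IJz (user_reg k) (p.+4 + size cb),
          ISub (user_reg k) (user_reg k) 2 & cb ++ [:: IJz 0 p.+1]]
  end.

Definition code_at (prog : seq instr) (p : nat) (cs : seq instr) : Prop :=
  forall i, i < size cs -> nth IHalt prog (p + i) = nth IHalt cs i.

Lemma code_at_cons prog p x cs :
  code_at prog p (x :: cs) -> nth IHalt prog p = x /\ code_at prog p.+1 cs.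
Proof.
move=> H; split=> [|i ics]; first by rewrite -[p]addn0 H.
by rewrite addSnnS (H i.+1).
Qed.

Lemma code_at_cat prog p c1 c2 :
  code_at prog p (c1 ++ c2) -> code_at prog p c1 /\ code_at prog (p + size c1) c2.
Proof.
move=> H; split=> i ic; first by rewrite H ?nth_cat ?ic // size_cat ltn_addr.
by rewrite -addnA H ?nth_cat ?size_cat ?ltn_add2l // ltnNge leq_addr addKn.
Qed.

(** * Safety, running time and Hoare-style rules *)

Section Layout.

Variables (B : nat) (sz base : nat -> nat).

(** Only constants and sums can create a word above [B]: truncated subtraction, copies and memory
    transfers stay below values already present. *)
Fixpoint safe (c : cmd) (s : store) : Prop :=
  match c with
  | CConst r v => v <= B
  | CAdd r a b => rg s a + rg s b <= B
  | CLoad r k i => rg s i < sz k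
  | CStore k i r => rg s i < sz k
  | CSeq a b => safe a s /\ safe b (eval a s)
  | CIf r a b => if rg s r == 0 then safe b s else safe a s
  | CFor k h b =>
      all_downto (fun m s => eval b (setr s k m)) (fun m s => safe b (setr s k m))
        (rg s h) (setr s k (rg s h))
  | _ => True
  end.

Definition hoare (c : cmd) (s : store) (T : nat) (P : store -> Prop) : Prop :=
  [/\ safe c s, time c s <= T & P (eval c s)].

Lemma spec_weaken c s T T' (P P' : store -> Prop) :
  hoare c s T P -> T <= T' -> (forall s', P s' -> P' s') -> hoare c s T' P'.
Proof. by case=> sa ti Ps TT PP; split; [|apply: leq_trans TT|apply: PP]. Qed.

(** The frame of [a] is handed to the second premise, so that [P] need only describe what [a]
    computes. *)
Lemma spec_seq a b s T1 T2 (P Q : store -> Prop) :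
  hoare a s T1 P ->
  (forall s', P s' -> (forall r, r \notin wr a -> rg s' r = rg s r) ->
     (forall k, k \notin awr a -> ar s' k = ar s k) -> hoare b s' T2 Q) ->
  hoare (CSeq a b) s (T1 + T2) Q.
Proof.
case=> sa ta Pa H; have [] := H _ Pa.
- by move=> r; apply: eval_rg.
- by move=> k; apply: eval_ar.
- by move=> sb tb Qb; split=> //=; apply: leq_add.
Qed.

(** [Inv m] describes the store once the iterations [n - 1] down to [m] are done. The bound [T] may
    depend on the iteration; this lets loops over adjacency lists cost a sum of degrees. *)
Lemma spec_for k h b s n T (Inv : nat -> store -> Prop) :
  rg s h = n -> Inv n (setr s k n) ->
  (forall m s', m < n -> Inv m.+1 s' ->
     (forall r, r \notin k :: wr b -> rg s' r = rg s r) ->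
     (forall q, q \notin awr b -> ar s' q = ar s q) ->
     hoare b (setr s' k m) (T m) (Inv m)) ->
  hoare (CFor k h b) s (2 + \sum_(m < n) (T m + 3)) (Inv 0).
Proof.
move=> hn; pose fr s' := (forall r, r \notin k :: wr b -> rg s' r = rg s r) /\
  (forall q, q \notin awr b -> ar s' q = ar s q).
have : fr (setr s k n).
  by split=> //= r; rewrite inE negb_or /upd => /andP[/negPf->].
rewrite /hoare /= hn; move: (setr s k n); elim: n {hn} => [|n IH] s' frs Is H /=.
  by split; rewrite // big_ord0.
have [sb tb Ib] := H n s' (ltnSn n) Is frs.1 frs.2.
have [||sa ta Ia] := IH (eval b (setr s' k n)) _ Ib.
- case: frs => f1 f2; split=> [r|q] Hr; last by rewrite eval_ar ?f2.
  have := Hr; rewrite inE negb_or => /andP[/negPf rk rb].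
  by rewrite eval_rg //= /upd rk f1.
- by move=> m s1 mn; apply: H; lia.
- by split=> //; rewrite big_ord_recr /=; lia.
Qed.

(** * Simulation of evaluation by machine steps *)

Definition bounded (x : state) : Prop :=
  (forall r, ram_reg x r <= B) /\ (forall a, ram_mem x a <= B).

Definition represents (x : state) (s : store) : Prop :=
  [/\ ram_reg x 0 = 0, ram_reg x 2 = 1,
      forall k, k < narrays -> ram_reg x (base_reg k) = base k,
      forall r, ram_reg x (user_reg r) = rg s r
    & forall k i, k < narrays -> i < sz k -> ram_mem x (base k + i) = ar s k i].

(** All intermediate states are included because the word bound must hold throughout the run. *)
Definition reaches (prog : seq instr) (t : nat) (x y : state) : Prop :=
  run prog t x = y /\ forall t', t' <= t -> bounded (run prog t' x).

Lemma reaches_refl prog x : bounded x -> reaches prog 0 x x.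
Proof. by move=> bx; split=> // t'; rewrite leqn0 => /eqP->. Qed.

Lemma reaches_step prog x y : bounded x -> bounded y -> step prog x = y ->
  reaches prog 1 x y.
Proof. by move=> bx by_ E; split=> // -[|[|//]] _ //; rewrite /run /= E. Qed.

Lemma reaches_trans prog t1 t2 x y z :
  reaches prog t1 x y -> reaches prog t2 y z -> reaches prog (t1 + t2) x z.
Proof.
case=> <- b1 [<- b2]; split=> [|t' t't]; first by rewrite /run addnC iterD.
case: (leqP t' t1) => [/b1//|t1t].
have -> : t' = (t' - t1) + t1 by lia.
by rewrite /run iterD; apply: b2; lia.
Qed.

Lemma reaches_last prog t x y : reaches prog t x y -> bounded y.
Proof. by case=> <- H; apply: H. Qed.

Lemma bounded_upd p R M r v : bounded (State p R M) -> v <= B ->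
  forall p', bounded (State p' (upd R r v) M).
Proof. by case=> b1 b2 vB p'; split=> //= q; rewrite /upd; case: ifP. Qed.

Lemma bounded_updm p R M a v : bounded (State p R M) -> v <= B ->
  forall p', bounded (State p' R (upd M a v)).
Proof. by case=> b1 b2 vB p'; split=> //= q; rewrite /upd; case: ifP. Qed.

Lemma represents_setr p R M s r v p' : represents (State p R M) s ->
  represents (State p' (upd R (user_reg r) v) M) (setr s r v).
Proof.
case=> /= h0 h2 hb hu hm; split=> //=.
- by rewrite /upd /user_reg; case: eqP => //; lia.
- by rewrite /upd /user_reg; case: eqP => //; lia.
- move=> k kn; rewrite /upd -hb //; case: eqP => //.
  by move: kn; rewrite /base_reg /user_reg /narrays; lia.
- by move=> q; rewrite /upd hu /user_reg eqn_add2r.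
Qed.

Lemma represents_tmp p R M s v p' : represents (State p R M) s ->
  represents (State p' (upd R 1 v) M) s.
Proof.
case=> /= h0 h2 hb hu hm; split=> //=.
- by move=> k kn; rewrite /upd -hb //; case: eqP => //; rewrite /base_reg; lia.
- by move=> q; rewrite /upd hu; case: eqP => //; rewrite /user_reg; lia.
Qed.

Hypothesis disj : forall k k' i i', k < narrays -> k' < narrays ->
  i < sz k -> i' < sz k' -> base k + i = base k' + i' -> k = k' /\ i = i'.
Hypothesis fits : forall k i, k < narrays -> i < sz k -> base k + i <= B.

Lemma represents_seta p R M s k i v p' : represents (State p R M) s ->
  k < narrays -> i < sz k ->
  represents (State p' R (upd M (base k + i) v)) (seta s k i v).
Proof.
case=> /= h0 h2 hb hu hm kn ik; split=> //= k' i' kn' ik'.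
rewrite /upd hm //; case: eqP => [E|ne].
  by have [-> ->] := disj kn' kn ik' ik E; rewrite !eqxx.
by case: (k' =P k) => // Ek; case: (i' =P i) => [Ei|_]; [case: ne; rewrite Ek Ei|rewrite Ek].
Qed.

Definition simulated (c : cmd) : Prop := forall prog p x s,
  code_at prog p (compile p c) -> ram_pc x = p -> represents x s -> bounded x ->
  safe c s ->
  exists y, [/\ reaches prog (time c s) x y, ram_pc y = p + size (compile p c)
    & represents y (eval c s)].

Lemma simulated_setr prog p R M s i r v : nth IHalt prog p = i ->
  step prog (State p R M) = State p.+1 (upd R (user_reg r) v) M ->
  represents (State p R M) s -> bounded (State p R M) -> v <= B ->
  exists y, [/\ reaches prog 1 (State p R M) y, ram_pc y = p + 1
    & represents y (setr s r v)].
Proof.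
move=> Ei st re bo vB; exists (State p.+1 (upd R (user_reg r) v) M); split=> /=.
- by apply: reaches_step => //; apply: bounded_upd bo _ _.
- by rewrite addn1.
- exact: represents_setr re.
Qed.

(** Induction on the command, with the step count matched exactly; loops need a second induction on
    the remaining iterations. *)
Lemma simulation c : well_formed c -> simulated c.
Proof.
rewrite /simulated; elim: c => [|r v|r a|r a b|r a b|r k i|k i r|a IHa b IHb|r a IHa b IHb|k h b IHb] wf
  prog p [p0 R M] s /= co E; rewrite -{p}E in co * => re bo sa.
- by exists (State p0 R M); split; [exact: reaches_refl|rewrite addn0|].
- have [Ei _] := code_at_cons co.
  by apply: (simulated_setr Ei) => //; rewrite /step /cur_instr /= Ei.
- have [Ei _] := code_at_cons co; have [/= h0 _ _ hu _] := re.
  apply: (simulated_setr Ei) => //; last by rewrite -hu; apply: bo.1.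
  by rewrite /step /cur_instr /= Ei hu h0 addn0.
- have [Ei _] := code_at_cons co; have [/= h0 _ _ hu _] := re.
  by apply: (simulated_setr Ei) => //; rewrite /step /cur_instr /= Ei !hu.
- have [Ei _] := code_at_cons co; have [/= h0 _ _ hu _] := re.
  apply: (simulated_setr Ei) => //; first by rewrite /step /cur_instr /= Ei !hu.
  by rewrite -hu; apply: leq_trans (leq_subr _ _) (bo.1 _).
- have [Ei /code_at_cons[Ej _]] := code_at_cons co; have [/= h0 _ hb hu hm] := re.
  have bi := fits wf sa.
  pose y := State p0.+1 (upd R 1 (base k + rg s i)) M.
  have st1 : step prog (State p0 R M) = y.
    by rewrite /step /cur_instr /= Ei; move: (hb _ wf) => /= ->; move: (hu i) => /= ->.
  have bo1 : bounded y by apply: bounded_upd bo bi _.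
  have re1 : represents y s by apply: represents_tmp re.
  have vB : ar s k (rg s i) <= B by rewrite -hm //; apply: bo.2.
  have st2 : step prog y = State p0.+2 (upd (upd R 1 (base k + rg s i)) (user_reg r) (ar s k (rg s i))) M.
    by rewrite /step /cur_instr /= Ej /upd /= -hm.
  have [z [rz pz repz]] := simulated_setr Ej st2 re1 bo1 vB.
  exists z; split=> //; last by rewrite pz addSnnS.
  by apply: (reaches_trans (t1 := 1)) rz; apply: reaches_step.
- have [Ei /code_at_cons[Ej _]] := code_at_cons co; have [/= h0 _ hb hu hm] := re.
  have bi := fits wf sa.
  pose y := State p0.+1 (upd R 1 (base k + rg s i)) M.
  have st1 : step prog (State p0 R M) = y.
    by rewrite /step /cur_instr /= Ei; move: (hb _ wf) => /= ->; move: (hu i) => /= ->.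
  have bo1 : bounded y by apply: bounded_upd bo bi _.
  have re1 : represents y s by apply: represents_tmp re.
  have bo2 : bounded (State p0.+2 (upd R 1 (base k + rg s i)) (upd M (base k + rg s i) (rg s r))).
    by apply: bounded_updm bo1 _ _; rewrite -hu; apply: bo.1.
  exists (State p0.+2 (upd R 1 (base k + rg s i)) (upd M (base k + rg s i) (rg s r))).
  split; last by apply: represents_seta re1 _ _.
    apply: (reaches_trans (t1 := 1) (y := y)); apply: reaches_step => //.
    by rewrite /step /cur_instr /= Ej; case: re1 => _ _ _ /= -> _; rewrite /upd /=.
  by rewrite /= addn2.
- case/andP: wf => wa wb; have [ca cb] := code_at_cat co; case: sa => sa sb.
  have [y [ry py repy]] := IHa wa _ _ (State p0 R M) _ ca erefl re bo sa.
  have [z [rz pz repz]] := IHb wb _ _ _ _ cb py repy (reaches_last ry) sb.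
  exists z; split=> //; first exact: reaches_trans ry rz.
  by rewrite pz size_cat addnA.
- case/andP: wf => wa wb; have [Ei co1] := code_at_cons co.
  have [ca /code_at_cons[Ej cb]] := code_at_cat co1; have [/= h0 _ _ hu _] := re.
  rewrite -addSn in cb.
  move: sa; case: ifP => r0 sa.
    pose y := State (p0.+2 + size (compile p0.+1 a)) R M.
    have r1 : reaches prog 1 (State p0 R M) y.
      by apply: reaches_step => //; rewrite /step /cur_instr /= Ei; move: (hu r) => /= ->; rewrite r0.
    have [z [rz pz repz]] := IHb wb _ _ y _ cb erefl re bo sa.
    exists z; split=> //; first exact: reaches_trans r1 rz.
    by rewrite pz size_cat /=; lia.
  pose y := State p0.+1 R M.
  have r1 : reaches prog 1 (State p0 R M) y.
    by apply: reaches_step => //; rewrite /step /cur_instr /= Ei; move: (hu r) => /= ->; rewrite r0.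
  have [[pz Rz Mz] [rz /= Epz repz]] := IHa wa _ _ y _ ca erefl re bo sa.
  set q := p0.+2 + _ + size _ in Ej.
  exists (State q Rz Mz); split=> //; last by rewrite /q /= size_cat /=; lia.
  have -> : 2 + time a s = 1 + (time a s + 1) by lia.
  apply: (reaches_trans r1); apply: (reaches_trans rz).
  have bz := reaches_last rz.
  apply: reaches_step => //; rewrite /step /cur_instr /= Epz Ej.
  by case: repz => /= ->.
- case/andP: wf => kb wb; have [Ei /code_at_cons[Ej /code_at_cons[El co1]]] := code_at_cons co.
  have [cb /code_at_cons[Em _]] := code_at_cat co1; have [/= h0 h2 _ hu _] := re.
  set n := rg s h; set q := _ + size _ in Ej.
  pose y := State p0.+1 (upd R (user_reg k) n) M.
  have nB : n <= B by rewrite /n -hu; apply: bo.1.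
  have by_ : bounded y by apply: bounded_upd bo _ _.
  have r1 : reaches prog 1 (State p0 R M) y.
    apply: reaches_step => //; rewrite /step /cur_instr /= Ei.
    by move: (hu h) h0 => /= -> ->; rewrite addn0.
  have rey : represents y (setr s k n) by apply: represents_setr re.
  (* Generalised to any state that stands at the loop test with counter value [n]. *)
  suff : forall n s' x, ram_pc x = p0.+1 -> represents x s' -> bounded x -> rg s' k = n ->
      all_downto (fun m s => eval b (setr s k m)) (fun m s => safe b (setr s k m)) n s' ->
      exists z, [/\ reaches prog
        (time_downto (fun m s => eval b (setr s k m)) (fun m s => time b (setr s k m)) n s') x z,
        ram_pc z = q & represents z (downto (fun m s => eval b (setr s k m)) n s')].
    case/(_ n _ y erefl rey by_ _ sa) => [|z [rz pz repz]]; first by rewrite /= /upd eqxx.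
    exists z; split=> //; first exact: reaches_trans r1 rz.
    by rewrite pz /q size_cat /=; lia.
  move: {n sa nB y by_ r1 rey} h0 h2 hu re bo => _ _ _ _ _.
  elim=> [|n IH] s' [px Rx Mx] /= -> rex box kn sa.
    exists (State q Rx Mx); split=> //; apply: reaches_step => //.
    by rewrite /step /cur_instr /= Ej; case: rex => _ _ _ /= -> _; rewrite kn.
  case: sa => sb sa; have [/= h0 h2 _ hu _] := rex.
  pose y := State p0.+2 Rx Mx.
  have r1 : reaches prog 1 (State p0.+1 Rx Mx) y.
    by apply: reaches_step => //; rewrite /step /cur_instr /= Ej; move: (hu k) => /= ->; rewrite kn.
  (* The counter register still holds [n.+1], which is bounded. *)
  have nB : n <= B by move: (box.1 (user_reg k)); rewrite /= hu kn; lia.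
  pose z := State p0.+3 (upd Rx (user_reg k) n) Mx.
  have bz : bounded z by apply: bounded_upd box _ _.
  have r2 : reaches prog 1 y z.
    apply: reaches_step => //; rewrite /step /cur_instr /= El.
    by move: (hu k) h2 => /= -> ->; rewrite kn subn1.
  have rez : represents z (setr s' k n) by apply: represents_setr rex.
  have [[pw Rw Mw] [rw /= pw' rew]] := IHb wb _ _ z _ cb erefl rez bz sb.
  have bw := reaches_last rw.
  have r4 : reaches prog 1 (State pw Rw Mw) (State p0.+1 Rw Mw).
    by apply: reaches_step => //; rewrite /step /cur_instr /= pw' Em; case: rew => /= ->.
  have [|u [ru pu repu]] := IH (eval b (setr s' k n)) (State p0.+1 Rw Mw) erefl rew bw _ sa.
    (* The body does not write [k], so the counter is still [n] after it. *)
    by rewrite eval_rg //= /upd eqxx.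
  exists u; split=> //.
  set tb := time b _ in rw *.
  have -> : 3 + tb = 1 + (1 + (tb + 1)) by lia.
  apply: reaches_trans ru; apply: (reaches_trans r1); apply: (reaches_trans r2).
  exact: reaches_trans rw r4.
Qed.

End Layout.

(** * The algorithm *)

Local Notation "a ;; b" := (CSeq a b) (at level 61, right associativity).

Local Notation rN := 0 (only parsing).
Local Notation rDeg := 1 (only parsing).
Local Notation rOff := 2 (only parsing).
Local Notation rJ := 3 (only parsing).
Local Notation rT := 4 (only parsing).
Local Notation rX := 5 (only parsing).
Local Notation rY := 6 (only parsing).
Local Notation rAcc := 7 (only parsing).
Local Notation rW := 8 (only parsing).
Local Notation rV := 9 (only parsing).
Local Notation rNN := 10 (only parsing).
Local Notation rBest := 11 (only parsing).
Local Notation rI := 12 (only parsing).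
Local Notation rP := 13 (only parsing).
Local Notation rD := 14 (only parsing).
Local Notation rBad := 15 (only parsing).
Local Notation rDBad := 16 (only parsing).
Local Notation rOne := 17 (only parsing).
Local Notation rU := 18 (only parsing).
Local Notation rJU := 19 (only parsing).
Local Notation rQ := 20 (only parsing).
Local Notation rFound := 21 (only parsing).
Local Notation rA := 22 (only parsing).
Local Notation rTwo := 23 (only parsing).
Local Notation rUni := 24 (only parsing).
Local Notation rCU := 25 (only parsing).
Local Notation rCode := 26 (only parsing).
Local Notation rZero := 27 (only parsing).
Local Notation rK := 28 (only parsing).
Local Notation rDV := 29 (only parsing).
Local Notation rOV := 30 (only parsing).

(* The memory is cut into seven arrays: the input, then arrays indexed by
   vertices.  [aOff] and [aDeg] give the position and length of each adjacency
   list, [aMk] is the indicator of N(v), [aD] that of the proposed e.d., [aNI]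
   lists the non-isolated vertices and [aCov] is the indicator of N(u) + N(v). *)
Local Notation aIn := 0 (only parsing).
Local Notation aOff := 1 (only parsing).
Local Notation aDeg := 2 (only parsing).
Local Notation aMk := 3 (only parsing).
Local Notation aD := 4 (only parsing).
Local Notation aNI := 5 (only parsing).
Local Notation aCov := 6 (only parsing).

(* The register [rW] holds the vertex whose adjacency list is traversed. *)
Definition sum_nbrs (src : nat) : cmd :=
  CLoad rDeg aDeg rW;; CLoad rOff aOff rW;; CConst rAcc 0;;
  CFor rJ rDeg
    (CAdd rT rOff rJ;; CLoad rX aIn rT;; CLoad rY src rX;; CAdd rAcc rAcc rY).

Definition mark_nbrs (dst : nat) : cmd :=
  CLoad rDeg aDeg rW;; CLoad rOff aOff rW;;
  CFor rJ rDeg (CAdd rT rOff rJ;; CLoad rX aIn rT;; CStore dst rX rOne).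

(** Truncated subtraction makes [rT] nonzero exactly when the new degree is strictly smaller than
    [rBest]. As [rBest] starts at n, above every degree, the first non-isolated vertex is always
    taken. *)
Definition parse_body : cmd :=
  CLoad rD aIn rP;; CAdd rP rP rOne;; CStore aDeg rI rD;; CStore aOff rI rP;;
  CAdd rP rP rD;;
  CIf rD
    (CStore aNI rNN rI;; CAdd rNN rNN rOne;; CSub rT rBest rD;;
     CIf rT (CMov rBest rD;; CMov rV rI) CSkip)
    CSkip;;
  CAdd rI rI rOne.

Definition parse : cmd :=
  CLoad rN aIn rZero;; CConst rOne 1;; CConst rP 2;; CMov rBest rN;;
  CFor rK rN parse_body.

(** For [w] other than [v], being far means that no vertex of the closed neighbourhood of [w] lies
    in N(v), so one minus the count is the indicator. The entry of [v] is set separately at the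
    end. *)
Definition candidate : cmd :=
  CMov rW rV;; mark_nbrs aMk;;
  CFor rW rN
    (sum_nbrs aMk;; CLoad rY aMk rW;; CAdd rAcc rAcc rY;; CSub rAcc rOne rAcc;;
     CStore aD rW rAcc);;
  CStore aD rV rOne.

(** [rT] is the distance of the domination count from 1, a sum of two truncated differences. [rDBad]
    records a failure at a member of D, which is always an excess and so reveals an edge inside
    D. *)
Definition check : cmd :=
  CFor rW rN
    (sum_nbrs aD;; CLoad rY aD rW;; CAdd rAcc rAcc rY;; CSub rT rAcc rOne;;
     CSub rX rOne rAcc;; CAdd rT rT rX;;
     CIf rT (CMov rBad rOne;; CIf rY (CMov rDBad rOne) CSkip) CSkip).

(* Only the entries of [aCov] at non-isolated vertices are refreshed: going
   through all n vertices for each u in N(v) would not be linear. *)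
Definition cover : cmd :=
  CFor rQ rNN (CLoad rX aNI rQ;; CLoad rY aMk rX;; CStore aCov rX rY);;
  CMov rW rU;; mark_nbrs aCov.

Definition find_uncovered : cmd :=
  CConst rFound 0;;
  CFor rQ rNN
    (CLoad rX aNI rQ;; CLoad rY aCov rX;;
     CIf rY CSkip (CMov rFound rOne;; CMov rA rX)).

(** When nothing is uncovered, comparing deg(u) + 1 with the number of non-isolated vertices tells
    whether [u] dominates all of them, since [u] and its neighbours are themselves non-isolated. *)
Definition search : cmd :=
  CLoad rDV aDeg rV;; CLoad rOV aOff rV;;
  CFor rJU rDV
    (CAdd rT rOV rJU;; CLoad rU aIn rT;; cover;; find_uncovered;;
     CIf rFound
       (CMov rW rA;; sum_nbrs aCov;; CLoad rD aDeg rA;; CSub rT rD rAcc;;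
        CIf rT (CMov rTwo rOne) CSkip)
       (CLoad rD aDeg rU;; CSub rT rNN rD;; CSub rT rT rOne;;
        CIf rT CSkip (CMov rUni rOne;; CMov rCU rU))).

Definition single_out : cmd :=
  CFor rW rN (CLoad rD aDeg rW;; CSub rD rOne rD;; CStore aD rW rD);;
  CStore aD rCU rOne.

(** Code 0 is the initial value of [rCode]: it is kept both when the candidate passes the check and
    when [single_out] replaces it. *)
Definition decide : cmd :=
  CIf rBad
    (CIf rDBad (CConst rCode 2)
      (search;;
       CIf rTwo (CConst rCode 2) (CIf rUni single_out (CConst rCode 1))))
    CSkip.

Definition output : cmd :=
  CFor rW rN (CLoad rY aD rW;; CAdd rX rW rOne;; CStore aIn rX rY);;
  CStore aIn rZero rCode.

Definition main : cmd := parse;; candidate;; check;; decide;; output.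

Lemma main_well_formed : well_formed main.
Proof. by []. Qed.

(** * Correctness and cost of each phase *)

Section Specs.

Variables (n : nat) (al : nat -> seq nat) (B L : nat).
Hypothesis Hal : adjacency n al.

(** The additional cell keeps the index [rV], which is 0 in the empty graph, within bounds. *)
Definition sizes (k : nat) : nat := if k == 0 then L else n.+1.

Hypotheses (LB : L <= B) (nB : n.+2 <= B) (nL : n.+2 <= L).

Local Notation spec := (hoare B sizes).

Lemma updE f a v x : upd f a v x = if x == a then v else f x. Proof. by []. Qed.

Definition graph_arrays (a : nat -> nat -> nat) : Prop := forall w, w <= n ->
  a aDeg w = size (al w) /\
  forall j, j < size (al w) -> a aOff w + j < L /\ a aIn (a aOff w + j) = nth 0 (al w) j.

Definition env (s : store) : Prop :=
  [/\ rg s rN = n, rg s rOne = 1 & graph_arrays (ar s)].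

Lemma env_frame s s' : env s -> rg s' rN = rg s rN -> rg s' rOne = rg s rOne ->
  ar s' aIn = ar s aIn -> ar s' aOff = ar s aOff -> ar s' aDeg = ar s aDeg -> env s'.
Proof. by rewrite /env /graph_arrays => h -> -> -> -> ->. Qed.

Lemma nbr_lt x j : j < size (al x) -> nth 0 (al x) j < n.
Proof. by move=> /(mem_nth 0); case: Hal => H _ _ _; apply: H. Qed.

Lemma degree_le x : size (al x) <= n.
Proof.
case: Hal => lt _ _ un; rewrite -[n in _ <= n](size_iota 0).
by apply: uniq_leq_size => // y /lt; rewrite mem_iota.
Qed.

Lemma spec_basic a b s T (Q : store -> Prop) : safe B sizes a s -> spec b (eval a s) T Q ->
  spec (a;; b) s (time a s + T) Q.
Proof. by move=> sa [sb tb Qb]; split=> //=; rewrite leq_add2l. Qed.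

Lemma spec_for_const k h b s m T (Inv : nat -> store -> Prop) :
  rg s h = m -> Inv m (setr s k m) ->
  (forall j s', j < m -> Inv j.+1 s' ->
     (forall r, r \notin k :: wr b -> rg s' r = rg s r) ->
     (forall q, q \notin awr b -> ar s' q = ar s q) ->
     spec b (setr s' k j) T (Inv j)) ->
  spec (CFor k h b) s (2 + m * (T + 3)) (Inv 0).
Proof.
move=> hm I0 H; have := @spec_for B sizes k h b s m (fun=> T) Inv hm I0 H.
by rewrite sum_nat_const card_ord.
Qed.

Lemma sum_nbrs_spec src s x (p : pred nat) :
  env s -> src < narrays -> src != 0 -> rg s rW = x -> x <= n ->
  (forall y, y \in al x -> ar s src y = p y) ->
  spec (sum_nbrs src) s (9 * size (al x) + 7) (fun s' => rg s' rAcc = count p (al x)).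
Proof.
move=> [_ _ ga] srcn /negPf src0 sW xn Hp; have [gd gn] := ga x xn.
have xs k : k != 0 -> x < sizes k by rewrite /sizes => /negPf->; lia.
(* The loop counts down, so the entries already summed form the suffix from position [m]. *)
pose Inv m s' := rg s' rAcc = count p (drop m (al x)).
apply: (@spec_weaken B sizes _ _ (2 + (2 + (1 + (2 + size (al x) * (6 + 3))))) _
  (Inv 0)); first last.
- by move=> s'; rewrite /Inv drop0.
- lia.
do 3 (apply: spec_basic => /=; first by rewrite /upd /= ?sW ?xs).
apply: (spec_for_const (Inv := Inv)) => /=.
- by rewrite /upd /= sW.
- by rewrite /Inv /upd /= drop_size.
move=> j s' jx IH fr fa.
have [oL oE] := gn j jx.
have yn := nbr_lt jx.
have sO : rg s' rOff = ar s aOff x by rewrite fr //= /upd /= sW.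
have ca : count p (drop j (al x)) = p (nth 0 (al x) j) + count p (drop j.+1 (al x)).
  by rewrite (drop_nth 0).
have cb : count p (drop j (al x)) <= n.
  by apply: leq_trans (count_size _ _) _; rewrite size_drop; have := degree_le x; lia.
rewrite /hoare /= /Inv /= /upd /= sO !fa // oE Hp ?mem_nth // IH; split=> //; last by rewrite ca addnC.
rewrite /sizes /= src0; split; [lia|split; [exact: oL|split; [lia|]]].
by rewrite addnC -ca; lia.
Qed.

Lemma mark_nbrs_spec dst s x :
  env s -> dst < narrays -> dst != 0 -> rg s rW = x -> x <= n ->
  spec (mark_nbrs dst) s (8 * size (al x) + 6)
    (fun s' => forall y, ar s' dst y = if y \in al x then 1 else ar s dst y).
Proof.
move=> [_ s1 ga] dn d0 sW xn; have [gd gn] := ga x xn.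
have xs k : k != 0 -> x < sizes k by rewrite /sizes => /negPf->; lia.
pose Inv m s' := forall y, ar s' dst y = if y \in drop m (al x) then 1 else ar s dst y.
apply: (@spec_weaken B sizes _ _ (2 + (2 + (2 + size (al x) * (5 + 3)))) _
  (Inv 0)); first last.
- by move=> s'; rewrite /Inv drop0.
- lia.
do 2 (apply: spec_basic => /=; first by rewrite /upd /= ?sW ?xs).
apply: (spec_for_const (Inv := Inv)) => /=.
- by rewrite /upd /= sW.
- by move=> y; rewrite drop_size.
move=> j s' jx IH fr fa.
have [oL oE] := gn j jx.
have yn := nbr_lt jx.
have sO : rg s' rOff = ar s aOff x by rewrite fr //= /upd /= sW.
have sI : ar s' 0 = ar s 0 by rewrite fa // inE eq_sym.
have sOne : rg s' rOne = 1 by rewrite fr.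
rewrite /hoare /= /Inv /= /upd /= sO sI oE sOne eqxx; split=> //.
  by rewrite /sizes /= (negPf d0); split; [lia|split; [exact: oL|lia]].
by move=> y; rewrite (drop_nth 0) // inE IH; case: eqP.
Qed.

(** Strictness is what makes n a valid starting value for the smallest degree seen. *)
Lemma degree_lt x : x < n -> size (al x) < n.
Proof.
case: Hal => lt _ irr un xn; rewrite -[n in _ < n](size_iota 0).
apply: (@uniq_leq_size _ (x :: al x)); first by rewrite /= irr un.
by move=> y; rewrite inE mem_iota => /orP[/eqP->|/lt].
Qed.

Lemma isolated_ge x : n <= x -> al x = [::].
Proof.
case: Hal => lt sym _ _ nx; case E: (al x) => [//|y t].
have : x \in al y by rewrite sym E mem_head.
by move/lt; rewrite ltnNge nx.
Qed.

(* Address of the length field of the i-th adjacency list in the input. *)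
Definition pos (i : nat) : nat := 2 + \sum_(l < i) (size (al l)).+1.

Definition nonisolated (i : nat) : seq nat := [seq w <- iota 0 i | al w != [::]].

Definition initial (s : store) : Prop :=
  [/\ forall r, rg s r = 0,
      forall k i, 0 < k -> ar s k i = 0,
      ar s aIn 0 = n
    & forall i, i < n -> ar s aIn (pos i) = size (al i) /\
        forall j, j < size (al i) -> ar s aIn ((pos i).+1 + j) = nth 0 (al i) j].

Definition parsed (s : store) : Prop :=
  [/\ env s, rg s rNN = size (nonisolated n),
      forall q, q < size (nonisolated n) -> ar s aNI q = nth 0 (nonisolated n) q,
      rg s rV <= n /\ (0 < n -> rg s rV < n)
    & min_degree n al (rg s rV)].

Hypothesis HL : L = pos n.

Lemma posS i : pos i.+1 = pos i + (size (al i)).+1.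
Proof. by rewrite /pos big_ord_recr /= addnA. Qed.

Lemma pos_mono i j : i <= j -> pos i <= pos j.
Proof.
elim: j => [|j IH]; first by rewrite leqn0 => /eqP->.
by rewrite leq_eqVlt => /orP[/eqP->//|/IH]; rewrite posS; lia.
Qed.

Lemma nonisolatedS i : nonisolated i.+1 =
  if al i == [::] then nonisolated i else rcons (nonisolated i) i.
Proof.
by rewrite /nonisolated -[i.+1]addn1 iotaD filter_cat /= add0n; case: eqP; rewrite ?cats0 ?cats1.
Qed.

Lemma size_nonisolated i : size (nonisolated i) <= i.
Proof. by rewrite size_filter -{2}(size_iota 0 i) count_size. Qed.

Lemma parse_spec s : initial s -> spec parse s (22 * n + 7) parsed.
Proof.
case=> s0 sa sn sin.
(* The counter falls while the input is read upwards, so [i] lists have been parsed when the counter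
   is [m]. The last clause separates whether a non-isolated vertex has been met. *)
pose Inv m s' := let i := n - m in
  [/\ [/\ rg s' rI = i, rg s' rP = pos i, rg s' rNN = size (nonisolated i)
       & forall q, q < size (nonisolated i) -> ar s' aNI q = nth 0 (nonisolated i) q],
      forall w, w < i -> ar s' aDeg w = size (al w) /\ ar s' aOff w = (pos w).+1,
      (* Cells not yet written stay 0; at [w = n] this encodes the empty list required by
         [graph_arrays]. *)
      forall w, i <= w -> w <= n -> ar s' aDeg w = 0,
      rg s' rV <= n /\ (0 < n -> rg s' rV < n)
    & [\/ [/\ al (rg s' rV) != [::], rg s' rBest = size (al (rg s' rV))
            & forall w, w < i -> al w != [::] -> rg s' rBest <= size (al w)]
        | rg s' rBest = n /\ forall w, w < i -> al w = [::]]].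
apply: (@spec_weaken B sizes _ _ (2 + (1 + (1 + (1 + (2 + n * (19 + 3)))))) _
  (fun s' => Inv 0 s' /\ [/\ rg s' rN = n, rg s' rOne = 1 & ar s' aIn = ar s aIn])); first last.
- move=> s' [[[hI hP hN hq] hw hw' hV hm] [h0 h1 ha]]; rewrite /= subn0 in hI hP hN hq hw hw' hm.
  split=> //.
    split=> // w; rewrite leq_eqVlt => /orP[/eqP->|wn].
      by rewrite hw' // isolated_ge.
    have [-> ->] := hw w wn; split=> // j jw.
    have [_ /(_ j jw)] := sin w wn; rewrite ha; split=> //.
    by have := pos_mono wn; rewrite posS HL; lia.
  move=> w wn w0; case: hm => [[v0 <- H]|[_ /(_ w wn) ww]]; first by split=> //; apply: H.
  by rewrite ww in w0.
- lia.
do 4 (apply: spec_basic => /=; first by rewrite /upd /sizes /= ?s0 //; lia).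
set s1 := setr _ _ _.
have [sf tf If] : spec (CFor rK rN parse_body) s1 (2 + n * (19 + 3)) (Inv 0); last first.
  split=> //; split=> //.
  by rewrite (@eval_rg _ _ 0) // (@eval_rg _ _ 17) // (@eval_ar _ _ 0) //= /upd /= s0 sn.
apply: (spec_for_const (Inv := Inv)).
- by rewrite /= /upd /= s0 sn.
- rewrite /Inv subnn /= /upd /= !s0 sn; split=> //; first by split=> //; rewrite /pos big_ord0.
  + by move=> w _ wn; rewrite sa.
  + by right.
move=> m s' mn [[]].
have -> : n - m.+1 = (n - m).-1 by lia.
have : n - m = (n - m).-1.+1 by lia.
have : (n - m).-1 < n by lia.
rewrite /Inv; move: (n - m).-1 => i iltn -> hI hP hN hq hw hw' hV hm fr fa.
have h0 : rg s' rN = n by rewrite fr //= /upd /= s0 sn.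
have h1 : rg s' rOne = 1 by rewrite fr.
have hin : ar s' aIn = ar s aIn by rewrite fa.
have [din _] := sin i iltn.
have posL : pos i.+1 <= L by rewrite HL; apply: pos_mono.
have sN := size_nonisolated i.
have dlt := degree_lt iltn.
rewrite posS in posL.
rewrite /hoare /= /upd /= !(hI, hP, hN, h1, hin, din) /sizes /=.
case d0: (size (al i) == 0) => /=.
  have ali : al i = [::] by apply: size0nil; apply/eqP.
  rewrite (eqP d0) /= !updE /= !(hI, hP, hN, h1) /=; split=> //; first by repeat split; lia.
  split=> //.
  - split; rewrite ?posS ?nonisolatedS ?ali ?eqxx //=; lia.
  - move=> w; rewrite ltnS leq_eqVlt !updE => /orP[/eqP->|wi]; first by rewrite !eqxx (eqP d0) addn1.
    by rewrite (ltn_eqF wi); apply: hw.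
  - move=> w iw wn; rewrite updE (gtn_eqF iw); apply: hw' => //; lia.
  - case: hm => [[v0 vb H]|[vb H]]; [left|right]; split=> // w; rewrite ltnS leq_eqVlt.
      by move=> /orP[/eqP->|/H//]; rewrite ali.
    by move=> /orP[/eqP->|/H//].
have ali : al i != [::] by rewrite -size_eq0 d0.
have szS : size (nonisolated i.+1) = (size (nonisolated i)).+1.
  by rewrite nonisolatedS (negPf ali) size_rcons.
have hq' q : q < (size (nonisolated i)).+1 ->
    upd (ar s' aNI) (size (nonisolated i)) i q = nth 0 (nonisolated i.+1) q.
  rewrite ltnS leq_eqVlt updE nonisolatedS (negPf ali) nth_rcons => /orP[/eqP->|qi].
    by rewrite ltnn eqxx.
  by rewrite (ltn_eqF qi) qi hq.
have hw1 w : w < i.+1 -> upd (ar s' aDeg) i (size (al i)) w = size (al w) /\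
    upd (ar s' aOff) i (pos i + 1) w = (pos w).+1.
  rewrite ltnS leq_eqVlt !updE => /orP[/eqP->|wi]; first by rewrite !eqxx addn1.
  by rewrite (ltn_eqF wi); apply: hw.
have hw2 w : i < w -> w <= n -> upd (ar s' aDeg) i (size (al i)) w = 0.
  by move=> iw wn; rewrite updE (gtn_eqF iw); apply: hw' => //; lia.
case t0: (rg s' rBest - size (al i) == 0).
  rewrite /= !updE /= !(hI, hP, hN, h1) /=; split=> //; first by repeat split; lia.
  split=> //.
  - rewrite posS szS; split=> //; lia.
  - left; case: hm => [[v0 vb H]|[vb H]]; last by move: t0; rewrite vb; lia.
    split=> // w; rewrite ltnS leq_eqVlt => /orP[/eqP-> _|/H//]; lia.
rewrite /= !updE /= !(hI, hP, hN, h1) /=; split=> //; first by repeat split; lia.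
split=> //.
- rewrite posS szS; split=> //; lia.
- by split=> //; lia.
- left; split=> // w; rewrite ltnS leq_eqVlt => /orP[/eqP-> //|wi] w0.
  case: hm => [[v0 vb H]|[vb H]]; last by rewrite H in w0.
  by apply: leq_trans (H w wi w0); lia.
Qed.

Definition candidate_found (s : store) : Prop :=
  (forall w, w < n -> ar s aD w = far al (rg s rV) w) /\
  (forall y, ar s aMk y = (y \in al (rg s rV))).

Lemma candidate_spec s : env s -> rg s rV <= n -> (forall y, ar s aMk y = 0) ->
  spec candidate s (9 * \sum_(w < n) size (al w) + 8 * n + 17 * n + 20) candidate_found.
Proof.
move=> es vn mk0; set v := rg s rV in vn *.
(* This is [far] without its exception for [v], which the final store of the phase supplies. *)
pose Inv m s' := forall w, m <= w -> w < n ->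
  ar s' aD w = (w \notin al v) && all (fun x => x \notin al v) (al w).
pose P s' := (forall w, w < n -> ar s' aD w = far al v w) /\
  (forall y, ar s' aMk y = (y \in al v)).
have vdeg := degree_le v.
apply: (@spec_weaken B sizes _ _ (1 + ((8 * size (al v) + 6) +
  ((2 + \sum_(w < n) (9 * size (al w) + 7 + 6 + 3)) + 2))) _
  (fun s' => P s' /\ rg s' rV = v)); first last.
- by move=> s' [PV E]; rewrite /candidate_found E.
- have -> : \sum_(w < n) (9 * size (al w) + 7 + 6 + 3) = 9 * \sum_(w < n) size (al w) + n * 16.
    rewrite big_distrr /= -[n in n * _]card_ord -sum_nat_const -big_split /=.
    by apply: eq_bigr => i _; lia.
  lia.
apply: spec_basic => //=.
set s1 := setr _ _ _.
have e1 : env s1 by apply: env_frame es _ _ _ _ _.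
apply: spec_seq (mark_nbrs_spec (dst := aMk) (x := v) e1 isT isT erefl vn) _ => s2 mk2 fr2 fa2.
have e2 : env s2 by apply: env_frame e1 _ _ _ _ _; rewrite ?fr2 ?fa2.
have mkE s' : ar s' aMk = ar s2 aMk -> forall y, ar s' aMk y = (y \in al v).
  by move=> -> y; rewrite mk2 [ar s1 _ _]mk0; case: (y \in al v).
have s2V : rg s2 rV = v by rewrite fr2.
apply: (@spec_seq _ _ _ _ _ _ _ (Inv 0)); last first.
  move=> s3 I3 fr3 fa3; have v3 : rg s3 rV = v by rewrite fr3.
  have o3 : rg s3 rOne = 1 by rewrite fr3 //; case: e2.
  split=> //=; first by rewrite v3.
  rewrite /P v3 o3; split=> //; split; last by apply: mkE; rewrite /= fa3.
  move=> w wn; rewrite /= !updE /far; case: eqP => //= _; exact: I3.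
apply: (spec_for (T := fun w => 9 * size (al w) + 7 + 6) (Inv := Inv)).
- by case: e2.
- by move=> w nw; rewrite ltnNge nw.
move=> w s3 wn IH fr3 fa3.
set s4 := setr _ _ _.
have e4 : env s4 by apply: env_frame e2 _ _ _ _ _; rewrite /= ?updE ?fr3 ?fa3.
have mk4 y : y \in al w -> ar s4 aMk y = (y \in al v) by move=> _; apply: mkE; rewrite /= fa3.
have sumw := @sum_nbrs_spec aMk s4 w (mem (al v)) e4 isT isT (erefl w) (ltnW wn) mk4.
apply: spec_seq sumw _.
move=> s5 acc5 fr5 fa5.
have w5 : rg s5 rW = w by rewrite fr5.
have o5 : rg s5 rOne = 1 by rewrite fr5 //; case: e4.
have mk5 : ar s5 aMk w = (w \in al v) by apply: mkE; rewrite fa5 //= fa3.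
rewrite /hoare /= !updE /= w5 mk5 acc5 o5 /sizes /=; split=> //.
  repeat split=> //; try lia.
  have := count_size (mem (al v)) (al w); have := degree_le w; case: (w \in al v) => /=; lia.
move=> x wx xn; rewrite /= updE; case: eqP => [->|/eqP xw]; last first.
  rewrite fa5 //=; apply: IH => //; lia.
rewrite all_predC has_count -[count (in_mem^~ _) _]/(count (mem (al v)) (al w)).
by case: (count _ _) => [|c]; case: (w \in al v) => /=; lia.
Qed.

Lemma check_spec s (D : pred nat) : env s -> (forall w, w < n -> ar s aD w = D w) ->
  rg s rBad = 0 -> rg s rDBad = 0 ->
  spec check s (9 * \sum_(w < n) size (al w) + 24 * n + 2) (fun s' =>
    rg s' rBad = has (fun w => dcount al D w != 1) (iota 0 n) /\
    rg s' rDBad = has (fun w => (dcount al D w != 1) && D w) (iota 0 n)).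
Proof.
move=> es sD b0 d0.
pose Inv m s' := rg s' rBad = has (fun w => dcount al D w != 1) (iota m (n - m)) /\
    rg s' rDBad = has (fun w => (dcount al D w != 1) && D w) (iota m (n - m)).
apply: (@spec_weaken B sizes _ _ (2 + \sum_(w < n) (9 * size (al w) + 7 + 14 + 3)) _
  (Inv 0)); first last.
- by move=> s'; rewrite /Inv subn0.
- have -> : \sum_(w < n) (9 * size (al w) + 7 + 14 + 3) = 9 * \sum_(w < n) size (al w) + n * 24.
    rewrite big_distrr /= -[n in n * _]card_ord -sum_nat_const -big_split /=.
    by apply: eq_bigr => i _; lia.
  lia.
apply: (spec_for (T := fun w => 9 * size (al w) + 7 + 14) (Inv := Inv)).
- by case: es.
- by rewrite /Inv subnn /= !updE /= b0 d0.
move=> w s3 wn IH fr3 fa3.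
set s4 := setr _ _ _.
have e4 : env s4 by apply: env_frame es _ _ _ _ _; rewrite /= ?updE ?fr3 ?fa3.
have D4 y : y < n -> ar s4 aD y = D y by rewrite /= fa3 //; apply: sD.
have D4' y : y \in al w -> ar s4 aD y = D y by case: Hal => lt _ _ _ /lt; apply: D4.
have sumw := @sum_nbrs_spec aD s4 w D e4 isT isT (erefl w) (ltnW wn) D4'.
apply: spec_seq sumw _ => s5 acc5 fr5 fa5.
have w5 : rg s5 rW = w by rewrite fr5.
have o5 : rg s5 rOne = 1 by rewrite fr5 //; case: e4.
have D5 : ar s5 aD w = D w by rewrite fa5 // D4.
have b5 : rg s5 rBad = rg s3 rBad by rewrite fr5.
have d5 : rg s5 rDBad = rg s3 rDBad by rewrite fr5.
have iotaE : iota w (n - w) = w :: iota w.+1 (n - w.+1) by rewrite -[n - w](@subnSK w n).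
have dcE : dcount al D w = count D (al w) + D w by rewrite /dcount addnC.
have cle : count D (al w) <= n by apply: leq_trans (count_size _ _) (degree_le w).
have Dle : D w <= 1 by case: (D w).
rewrite /hoare /= !updE /= w5 acc5 D5 o5 -dcE.
set d := dcount al D w; set t := d - 1 + (1 - d).
have dle : d <= n.+1 by rewrite /d dcE; lia.
have tE : (t == 0) = (d == 1) by rewrite /t; lia.
rewrite /Inv iotaE /= -/d tE.
case d1 : (d == 1) => /=.
  rewrite !updE /= b5 d5; split=> //; repeat split; rewrite /sizes /= /t; lia.
case: (D w) => /=; rewrite !updE /= ?b5 ?d5 ?o5; split=> //; try by repeat split=> //; rewrite /sizes /= /t; lia.
by rewrite IH.2.
Qed.

Definition nonisolated_stored (s : store) : Prop :=
  rg s rNN = size (nonisolated n) /\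
  forall q, q < size (nonisolated n) -> ar s aNI q = nth 0 (nonisolated n) q.

Lemma nonisolated_frame s s' : nonisolated_stored s -> rg s' rNN = rg s rNN ->
  ar s' aNI = ar s aNI -> nonisolated_stored s'.
Proof. by rewrite /nonisolated_stored => h -> ->. Qed.

Lemma mem_nonisolated x : (x \in nonisolated n) = (x < n) && (al x != [::]).
Proof. by rewrite mem_filter mem_iota andbC. Qed.

Lemma nth_nonisolated_lt q : q < size (nonisolated n) -> nth 0 (nonisolated n) q < n.
Proof. by move/(mem_nth 0); rewrite mem_nonisolated => /andP[]. Qed.

Lemma nbr_nonisolated x y : y \in al x -> y \in nonisolated n.
Proof.
case: Hal => lt sym _ _ yx; rewrite mem_nonisolated (lt x) //.
by move: yx; rewrite sym; case: (al y).
Qed.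

(** Lets the traversal of one adjacency list be charged to the number of non-isolated vertices. *)
Lemma degree_le_nonisolated x : size (al x) <= size (nonisolated n).
Proof. by apply: uniq_leq_size; [case: Hal|move=> y; apply: nbr_nonisolated]. Qed.

Lemma cover_spec s u v : env s -> nonisolated_stored s -> rg s rU = u -> u <= n ->
  (forall y, ar s aMk y = (y \in al v)) ->
  spec cover s (17 * size (nonisolated n) + 9)
    (fun s' => forall y, y \in nonisolated n -> ar s' aCov y = covered al u v y).
Proof.
move=> es [nn ni] su un mk; set N := nonisolated n in nn ni *.
pose Inv m s' := forall q, m <= q -> q < size N -> ar s' aCov (nth 0 N q) = (nth 0 N q \in al v).
apply: (@spec_weaken B sizes _ _ (2 + size N * (6 + 3) + (1 + (8 * size (al u) + 6))) _ _); first last.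
- by move=> s'; apply.
- have := degree_le_nonisolated u; rewrite -/N; lia.
apply: (@spec_seq _ _ _ _ _ _ _ (Inv 0)).
  apply: (spec_for_const (Inv := Inv)) => //=.
  - by move=> q Nq; rewrite ltnNge Nq.
  move=> m s' mN IH fr fa.
  have xn := nth_nonisolated_lt mN; rewrite -/N in xn.
  rewrite /hoare /= !updE /= !fa // ni // mk /sizes /=; split=> //.
    by repeat split=> //; have := size_nonisolated n; rewrite -/N; lia.
  (* If entry [q] names the vertex just written, the stored value is right for it too. *)
  move=> q mq qN; rewrite /= updE; case: eqP => [->//|ne].
  by apply: IH => //; rewrite ltn_neqAle mq andbT; apply/eqP => E; apply: ne; rewrite E.
move=> s1 I1 fr1 fa1.
apply: spec_basic => //=; set s2 := setr _ _ _.
have e2 : env s2 by apply: env_frame es _ _ _ _ _; rewrite /= ?updE ?fr1 ?fa1.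
have w2 : rg s2 rW = u by rewrite /= updE /= fr1.
apply: spec_weaken (@mark_nbrs_spec aCov s2 u e2 isT isT w2 un) (leqnn _) _.
move=> s3 H y /(nthP 0)[q qN <-]; rewrite H /covered; case: ifP => _; first by rewrite orbT.
by rewrite orbF /= I1.
Qed.

Lemma find_uncovered_spec s (p : pred nat) : env s -> nonisolated_stored s ->
  (forall y, y \in nonisolated n -> ar s aCov y = p y) ->
  spec find_uncovered s (12 * size (nonisolated n) + 3) (fun s' =>
    if rg s' rFound == 0 then {in nonisolated n, forall y, p y}
    else rg s' rA \in nonisolated n /\ ~~ p (rg s' rA)).
Proof.
move=> es [nn ni] cov; set N := nonisolated n in nn ni cov *.
pose Inv m s' := if rg s' rFound == 0 then forall q, m <= q -> q < size N -> p (nth 0 N q)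
  else rg s' rA \in N /\ ~~ p (rg s' rA).
apply: (@spec_weaken B sizes _ _ (1 + (2 + size N * (9 + 3))) _ (Inv 0)); first last.
- move=> s'; rewrite /Inv; case: eqP => // _ H y /(nthP 0)[q qN <-]; exact: H.
- lia.
apply: spec_basic => /=; first lia.
apply: (spec_for_const (Inv := Inv)) => //=.
- by rewrite /Inv /= => q Nq; rewrite ltnNge Nq.
move=> m s' mN IH fr fa.
have xn := nth_nonisolated_lt mN; rewrite -/N in xn.
have o1 : rg s' rOne = 1 by rewrite fr //=; case: es.
have xN : nth 0 N m \in N by apply: mem_nth.
rewrite /hoare /= !updE /= !fa // ni // cov // /sizes /= o1.
have := size_nonisolated n; rewrite -/N => Nn.
case px: (p _) => /=.
  split=> //; first by repeat split; lia.
  rewrite /Inv /= !updE /=; move: IH; rewrite /Inv; case: eqP => // _ H q.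
  by rewrite leq_eqVlt => /orP[/eqP<-|]; [rewrite px|apply: H].
split=> //; first by repeat split; lia.
by rewrite /Inv /= !updE /= px.
Qed.

Lemma spec_if r a b s T (Q : store -> Prop) :
  (rg s r == 0 -> spec b s T Q) -> (rg s r != 0 -> spec a s T Q) ->
  spec (CIf r a b) s (T + 2) Q.
Proof.
rewrite /hoare /=; case: eqP => _ Hb Ha.
  by have [sb tb Qb] := Hb isT; split=> //; lia.
by have [sa ta Qa] := Ha isT; split=> //; lia.
Qed.

Definition searched (v : nat) (s : store) : Prop :=
  [/\ rg s rTwo != 0 -> has2P2 al,
      rg s rUni != 0 -> [/\ rg s rCU < n, al (rg s rCU) != [::]
        & dominating_vertex n al (rg s rCU)]
    & rg s rTwo = 0 -> rg s rUni = 0 ->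
        forall u X, u \in al v -> ed n al X -> ~ X u].

Lemma search_spec s v : env s -> nonisolated_stored s -> rg s rV = v -> v <= n ->
  min_degree n al v -> (forall y, ar s aMk y = (y \in al v)) ->
  rg s rTwo = 0 -> rg s rUni = 0 ->
  spec search s (size (al v) * (38 * size (nonisolated n) + 38) + 6) (searched v).
Proof.
move=> es ns sV vn mv mk two0 uni0; set N := nonisolated n in ns *.
(* A raised flag carries its certificate; while both are zero, no neighbour of [v] tried so far lies
   in an e.d. *)
pose Inv m s' := [/\ rg s' rTwo != 0 -> has2P2 al,
      rg s' rUni != 0 -> [/\ rg s' rCU < n, al (rg s' rCU) != [::]
        & dominating_vertex n al (rg s' rCU)]
    & rg s' rTwo = 0 -> rg s' rUni = 0 ->
        forall u X, u \in drop m (al v) -> ed n al X -> ~ X u].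
apply: (@spec_weaken B sizes _ _ (2 + (2 + (2 + size (al v) * (38 * size N + 35 + 3)))) _ (Inv 0)); first last.
- by move=> s'; rewrite /Inv drop0.
- lia.
have [gd gn] : ar s aDeg v = size (al v) /\ forall j, j < size (al v) ->
    ar s aOff v + j < L /\ ar s aIn (ar s aOff v + j) = nth 0 (al v) j by case: es => _ _; apply.
do 2 (apply: spec_basic; first by rewrite /= ?updE /= sV /sizes /=; lia).
set s0 := eval _ _.
have s0E : s0 = setr (setr s rDV (size (al v))) rOV (ar s aOff v).
  by rewrite /s0 /= updE /= sV gd.
move: {s0} (s0) s0E => s0 s0E.
have e0 : env s0 by apply: env_frame es _ _ _ _ _; rewrite s0E /= ?updE.
apply: (spec_for_const (Inv := Inv)).
- by rewrite s0E /= !updE.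
- rewrite /Inv s0E /= !updE /= two0 uni0; split=> // _ _ u X; by rewrite drop_size.
move=> m s1 mv' IH fr1 fa1.
have [oL oE] := gn m mv'.
have ov1 : rg s1 rOV = ar s aOff v by rewrite fr1 // s0E /= updE.
have in1 : ar s1 aIn = ar s aIn by rewrite fa1 // s0E.
have e1 : env s1 by apply: env_frame e0 _ _ _ _ _; rewrite ?fr1 ?fa1.
have n1 : nonisolated_stored s1.
  by apply: nonisolated_frame ns _ _; rewrite ?fr1 ?fa1 // s0E.
have mk1 y : ar s1 aMk y = (y \in al v) by rewrite fa1 // s0E /= mk.
set u := nth 0 (al v) m in oE.
have uv : u \in al v by apply: mem_nth.
have un : u <= n by apply: ltnW; apply: nbr_lt.
apply: (@spec_weaken B sizes _ _ (1 + (2 + ((17 * size N + 9) + ((12 * size N + 3) + (9 * size N + 18 + 2))))) _ (Inv m)) => //; last by lia.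
do 2 (apply: spec_basic; first by rewrite /= !updE /= ov1 /sizes /=; lia).
set s2 := eval _ _.
have s2E : s2 = setr (setr (setr s1 rJU m) rT (ar s aOff v + m)) rU u.
  by rewrite /s2 /= !updE /= ov1 in1 oE.
move: {s2} (s2) s2E => s2 s2E.
have e2 : env s2 by apply: env_frame e1 _ _ _ _ _; rewrite s2E.
have n2 : nonisolated_stored s2 by apply: nonisolated_frame n1 _ _; rewrite s2E.
have mk2 y : ar s2 aMk y = (y \in al v) by rewrite s2E /= mk1.
have u2 : rg s2 rU = u by rewrite s2E /= updE.
apply: spec_seq (cover_spec e2 n2 u2 un mk2) _ => s3 cov3 fr3 fa3.
have e3 : env s3 by apply: env_frame e2 _ _ _ _ _; rewrite ?fr3 ?fa3.
have n3 : nonisolated_stored s3 by apply: nonisolated_frame n2 _ _; rewrite ?fr3 ?fa3.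
apply: spec_seq (find_uncovered_spec e3 n3 cov3) _ => s4 found4 fr4 fa4.
have e4 : env s4 by apply: env_frame e3 _ _ _ _ _; rewrite ?fr4 ?fa4.
have o4 : rg s4 rOne = 1 by case: e4.
have keep r : r \in [:: rTwo; rUni; rCU] -> rg s4 r = rg s1 r.
  by rewrite !inE => /or3P[]/eqP->; rewrite fr4 // fr3 // s2E.
have u4 : rg s4 rU = u by rewrite fr4 // fr3.
have nn4 : rg s4 rNN = size N by rewrite fr4 // fr3 // s2E; case: n1.
have cov4 : ar s4 aCov = ar s3 aCov by rewrite fa4.
have deg4 w : w <= n -> ar s4 aDeg w = size (al w) by case: e4 => _ _ g /g[].
case: IH => two uni none.
have dropE : drop m (al v) = u :: drop m.+1 (al v) by rewrite (drop_nth 0).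
apply: spec_if => found0; move: found4; rewrite ?(negPf found0) ?found0.
  move=> allcov.
  have subN : {subset u :: al u <= N}.
    move=> y; rewrite inE => /orP[/eqP->|]; last exact: nbr_nonisolated.
    exact: nbr_nonisolated uv.
  have unU : uniq (u :: al u) by case: Hal => _ _ irr uq; rewrite /= irr uq.
  rewrite /hoare /= !updE /= u4 nn4 o4 deg4 // /sizes /=.
  case t0: (_ == 0) => /=; split=> //; try by repeat split=> //; lia.
    rewrite /Inv /= !updE /= (keep rTwo) // ?u4; split=> // _.
    have ult : u < n by apply: nbr_lt.
    split=> // [|b bn b0].
      by case: Hal => _ sym _ _; move: uv; rewrite sym; case: (al u).
    (* A duplicate-free sublist at least as long as [N] has the same members, so [u] dominates every
       non-isolated vertex. *)
    have szN : size N <= size (u :: al u) by rewrite /=; lia.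
    have [_ E] := uniq_min_size unU subN szN.
    have : b \in u :: al u by rewrite E mem_nonisolated bn.
    by rewrite inE => /orP[/eqP|]; [left|right].
  rewrite /Inv /= !updE /= !keep //; split=> // tw un0 w X; rewrite dropE inE.
  case/orP=> [/eqP->|]; last exact: none.
  move=> edX Xu; have dv : dominating_vertex n al u.
    apply: (all_covered_dominating Hal uv _ edX Xu) => b bn b0.
    by apply: allcov; rewrite mem_nonisolated bn.
  (* Membership of [u] in an e.d. would make it dominating, contradicting the nonzero difference of
     sizes. *)
  have : size N <= size (u :: al u).
    apply: uniq_leq_size; first by rewrite filter_uniq ?iota_uniq.
    move=> b; rewrite mem_nonisolated => /andP[bn b0]; rewrite inE.
    by case: (dv b bn b0) => [->|->]; rewrite ?eqxx ?orbT.
  by rewrite /=; lia.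
set a := rg s4 rA => -[aN ncov].
have [an a0] : a < n /\ al a != [::] by apply/andP; rewrite -mem_nonisolated.
have dega := degree_le_nonisolated a; rewrite -/N in dega.
apply: (@spec_weaken B sizes _ _ (1 + ((9 * size (al a) + 7) + 8)) _ (Inv m)) => //; last by lia.
apply: spec_basic => //=; set s5 := setr _ _ _.
have e5 : env s5 by apply: env_frame e4 _ _ _ _ _.
have cov5 y : y \in al a -> ar s5 aCov y = covered al u v y.
  by move=> ya; rewrite /= cov4 cov3 //; apply: nbr_nonisolated ya.
have w5 : rg s5 rW = a by rewrite /= updE.
have sumw := @sum_nbrs_spec aCov s5 a (covered al u v) e5 isT isT w5 (ltnW an) cov5.
apply: spec_seq sumw _ => s6 acc6 fr6 fa6.
have a6 : rg s6 rA = a by rewrite fr6.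
have o6 : rg s6 rOne = 1 by rewrite fr6.
have deg6 : ar s6 aDeg a = size (al a) by rewrite fa6 //=; apply: deg4; apply: ltnW.
have keep6 r : r \in [:: rTwo; rUni; rCU] -> rg s6 r = rg s1 r.
  by move=> rin; rewrite -keep // fr6 ?fr5 //; move: rin; rewrite !inE => /or3P[]/eqP->.
(* The difference counts the uncovered neighbours of [a]. *)
have allE : (size (al a) - count (covered al u v) (al a) == 0) = all (covered al u v) (al a).
  by rewrite all_count subn_eq0 eqn_leq count_size.
rewrite /hoare /= !updE /= a6 acc6 deg6 allE /sizes /=.
case: ifP => all0 /=; split=> //; try by repeat split=> //; lia.
  rewrite /Inv /= !updE /= !keep6 //; split=> // tw un0 w X; rewrite dropE inE.
  case/orP=> [/eqP-> edX|]; last exact: none.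
  exact: (uncovered_not_ed Hal mv uv an a0 ncov all0 edX).
rewrite /Inv /= !updE /= o6 !keep6 //; split=> // _.
have /allPn[b ba nb] := negbT all0.
exact: uncovered_edge_2P2 uv ncov ba nb.
Qed.

Lemma single_out_spec s u : env s -> rg s rCU = u -> u <= n ->
  spec single_out s (8 * n + 4) (fun s' =>
    forall w, w < n -> ar s' aD w = (w == u) || (al w == [::])).
Proof.
move=> es su un.
pose Inv m s' := forall w, m <= w -> w < n -> ar s' aD w = (al w == [::]).
apply: (@spec_weaken B sizes _ _ (2 + n * (5 + 3) + 2) _ _); first last.
- by move=> s'; apply.
- lia.
apply: (@spec_seq _ _ _ _ _ _ _ (Inv 0)).
  apply: (spec_for_const (Inv := Inv)) => //=.
  - by case: es.
  - by move=> w nw; rewrite ltnNge nw.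
  move=> m s' mn IH fr fa.
  have o1 : rg s' rOne = 1 by rewrite fr //; case: es.
  have dm : ar s' aDeg m = size (al m) by rewrite fa //; case: es => _ _ /(_ m (ltnW mn))[].
  rewrite /hoare /= !updE /= dm o1 /sizes /=; split=> //; first by repeat split=> //; lia.
  move=> w mw wn; rewrite /= updE; case: eqP => [->|/eqP ne].
    by case: (al m) => //= ? ?; rewrite subSS.
  apply: IH => //; lia.
move=> s1 I1 fr1 fa1.
have o1 : rg s1 rOne = 1 by rewrite fr1 //; case: es.
have u1 : rg s1 rCU = u by rewrite fr1.
rewrite /hoare /= u1 o1 /sizes /=; split=> // w wn.
by rewrite updE; case: eqP => //= _; apply: I1.
Qed.

Definition decided (s : store) : Prop :=
  [\/ rg s rCode = 0 /\ exists2 X, ed n al X & forall w, w < n -> ar s aD w = X w,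
      rg s rCode = 1 /\ forall X, ~ ed n al X
    | rg s rCode = 2 /\ has2P2 al].

Lemma decide_spec s v : env s -> nonisolated_stored s -> rg s rV = v ->
  v <= n -> (0 < n -> v < n) -> min_degree n al v ->
  (forall y, ar s aMk y = (y \in al v)) -> (forall w, w < n -> ar s aD w = far al v w) ->
  rg s rBad = has (fun w => dcount al (far al v) w != 1) (iota 0 n) ->
  rg s rDBad = has (fun w => (dcount al (far al v) w != 1) && far al v w) (iota 0 n) ->
  rg s rTwo = 0 -> rg s rUni = 0 -> rg s rCode = 0 ->
  spec decide s (size (al v) * (38 * size (nonisolated n) + 38) + 8 * n + 20) decided.
Proof.
move=> es ns sV vn vn' mv mk sD bad dbad two uni code.
set T := size (al v) * _.
apply: (@spec_weaken B sizes _ _ (T + 6 + (8 * n + 4 + 2 + 2) + 2 + 2) _ decided) => //; last by lia.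
apply: spec_if => b0.
  split=> //=; constructor 1; split=> //; exists (far al v) => // w wn.
  move: b0; rewrite bad eqb0 => /hasPn/(_ w); rewrite mem_iota => /(_ wn).
  by rewrite negbK => /eqP.
have [x xn xbad] : exists2 x, x < n & dcount al (far al v) x != 1.
  move: b0; rewrite bad eqb0 negbK => /hasP[x]; rewrite mem_iota => xn xb.
  by exists x.
apply: spec_if => d0; last first.
  split=> //=; [lia|lia|constructor 3; split=> //].
  move: d0; rewrite dbad eqb0 negbK => /hasP[w]; rewrite mem_iota => wn /andP[/eqP wb wf].
  exact: (far_adjacent_2P2 Hal mv wn wf wb).
have ind w : w < n -> far al v w -> dcount al (far al v) w = 1.
  move=> wn wf; move: d0; rewrite dbad eqb0 => /hasPn/(_ w).
  by rewrite mem_iota wf andbT negbK => /(_ wn)/eqP.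
apply: spec_seq (search_spec es ns sV vn mv mk two uni) _ => s1 [h2 hu none] fr fa.
have e1 : env s1 by apply: env_frame es _ _ _ _ _; rewrite ?fr ?fa.
apply: spec_if => t0; last first.
  split=> //=; [lia|lia|by constructor 3; split=> //; apply: h2].
apply: spec_if => u0; last first.
  have [un a0 dv] := hu u0.
  have [sa ti post] := single_out_spec e1 erefl (ltnW un).
  split=> //; constructor 1; split; first by rewrite eval_rg // fr.
  by eexists; [exact: (dominating_vertex_ed Hal a0 dv)|exact: post].
split=> //=; [lia|lia|constructor 2; split=> // X eX].
have vlt : v < n by apply: vn'; lia.
(* Any e.d. dominates [v] either by [v] itself, which forces the rejected candidate, or by a
   neighbour, which the search has excluded. *)
have [|d Xd /orP[/eqP dv|dv]] := @dcount_ex al X v; first by rewrite eX.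
  have := ed_far_unique Hal ind eX; rewrite -{1}dv => /(_ Xd)/(_ x xn) E.
  by rewrite E in xbad.
exact: (none (eqP t0) (eqP u0) d X dv eX Xd).
Qed.

Lemma output_spec s : env s -> rg s rZero = 0 ->
  spec output s (8 * n + 4) (fun s' => ar s' aIn 0 = rg s rCode /\
    forall w, w < n -> ar s' aIn w.+1 = ar s aD w).
Proof.
move=> es z0.
pose Inv m s' := forall w, m <= w -> w < n -> ar s' aIn w.+1 = ar s aD w.
apply: (@spec_weaken B sizes _ _ (2 + n * (5 + 3) + 2) _ _); first last.
- by move=> s'; apply.
- lia.
apply: (@spec_seq _ _ _ _ _ _ _ (Inv 0)).
  apply: (spec_for_const (Inv := Inv)) => //=.
  - by case: es.
  - by move=> w nw; rewrite ltnNge nw.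
  move=> m s' mn IH fr fa.
  have o1 : rg s' rOne = 1 by rewrite fr //; case: es.
  rewrite /hoare /= !updE /= o1 /sizes /=; split=> //; first by repeat split=> //; lia.
  move=> w mw wn; rewrite /= updE addn1 eqSS; case: eqP => [->|/eqP ne].
    by rewrite fa.
  apply: IH => //; lia.
move=> s1 I1 fr1 fa1.
have z1 : rg s1 rZero = 0 by rewrite fr1.
have c1 : rg s1 rCode = rg s rCode by rewrite fr1.
rewrite /hoare /= z1 c1 /sizes /=; split=> //; first by lia.
by split=> // w wn; rewrite updE /=; apply: I1.
Qed.

(* Pays for the search, which costs O(number of non-isolated vertices) for each
   neighbour of [v]. *)
Lemma min_degree_sum v : min_degree n al v ->
  size (al v) * size (nonisolated n) <= \sum_(w < n) size (al w).
Proof.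
move=> mv; rewrite -(big_mkord xpredT (fun w => size (al w))) /index_iota subn0.
rewrite (bigID (fun w => al w != [::])) /= -[\sum_(w <- _ | al w != _) _]big_filter -/(nonisolated n).
apply: leq_trans (leq_addr _ _).
rewrite mulnC -sum1_size big_distrl /= big_seq [X in _ <= X]big_seq.
apply: leq_sum => w; rewrite mem_nonisolated mul1n => /andP[wn w0].
by have [] := mv w wn w0.
Qed.

Definition answer (M : nat -> nat) : Prop :=
  [\/ M 0 = 0 /\ exists2 X, ed n al X & forall w, w < n -> M w.+1 = X w,
      M 0 = 1 /\ forall X, ~ ed n al X
    | M 0 = 2 /\ has2P2 al].

Lemma main_spec s : initial s ->
  spec main s (130 * (n + \sum_(w < n) size (al w) + 1)) (fun s' => answer (ar s' aIn)).
Proof.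
move=> is0; have [s0 sa _ _] := is0; set S := \sum_(w < n) _.
(* The five phases in order; the coefficients of [n] add up to 125, the largest total, which 130
   covers. *)
apply: (@spec_weaken B sizes _ _ (22 * n + 7 + ((9 * S + 8 * n + 17 * n + 20) +
  ((9 * S + 24 * n + 2) + ((38 * S + 38 * n + 8 * n + 20) + (8 * n + 4))))) _ _); first last.
- by move=> s'; apply.
- lia.
apply: spec_seq (parse_spec is0) _ => s1 [e1 nn1 ni1 [vn vn'] mv] fr1 fa1.
have n1 : nonisolated_stored s1 by [].
pose flags := [:: rBad; rDBad; rTwo; rUni; rCode; rZero].
have z1 r : r \in flags -> rg s1 r = 0.
  move=> rin; rewrite fr1 //; move: rin; rewrite !inE.
  by case/or4P=> [/eqP->|/eqP->|/eqP->|/or3P[]/eqP->].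
have mk1 y : ar s1 aMk y = 0 by rewrite fa1 // sa.
set v := rg s1 rV in vn vn' mv.
apply: spec_seq (candidate_spec e1 vn mk1) _ => s2 [D2 mk2] fr2 fa2.
have v2 : rg s2 rV = v by rewrite fr2.
rewrite v2 in D2 mk2.
have e2 : env s2 by apply: env_frame e1 _ _ _ _ _; rewrite ?fr2 ?fa2.
have n2 : nonisolated_stored s2 by apply: nonisolated_frame n1 _ _; rewrite ?fr2 ?fa2.
have z2 r : r \in flags -> rg s2 r = 0.
  move=> rin; rewrite fr2 ?z1 //; move: rin; rewrite !inE.
  by case/or4P=> [/eqP->|/eqP->|/eqP->|/or3P[]/eqP->].
apply: spec_seq (check_spec e2 D2 (z2 rBad isT) (z2 rDBad isT)) _ => s3 [b3 d3] fr3 fa3.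
have e3 : env s3 by apply: env_frame e2 _ _ _ _ _; rewrite ?fr3 ?fa3.
have n3 : nonisolated_stored s3 by apply: nonisolated_frame n2 _ _; rewrite ?fr3 ?fa3.
have v3 : rg s3 rV = v by rewrite fr3.
have mk3 y : ar s3 aMk y = (y \in al v) by rewrite fa3.
have D3 w : w < n -> ar s3 aD w = far al v w by rewrite fa3 //; apply: D2.
have z3 r : r \in [:: rTwo; rUni; rCode; rZero] -> rg s3 r = 0.
  move=> rin; rewrite fr3 ?z2 //; move: rin; rewrite !inE.
    by case/or4P=> /eqP->.
  by case/or4P=> /eqP->.
have dec := decide_spec e3 n3 v3 vn vn' mv mk3 D3 b3 d3 (z3 rTwo isT) (z3 rUni isT) (z3 rCode isT).
apply: spec_seq (spec_weaken dec _ (fun s' H => H)) _.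
  (* The product deg(v) times the number of non-isolated vertices is at most [S], and deg(v) is at
     most [n]; the search is therefore linear. *)
  have := min_degree_sum mv; have := degree_le v; rewrite -/S; nia.
move=> s4 d4 fr4 fa4.
have e4 : env s4 by apply: env_frame e3 _ _ _ _ _; rewrite ?fr4 ?fa4.
have z4 : rg s4 rZero = 0 by rewrite fr4 // z3.
apply: spec_weaken (output_spec e4 z4) (leqnn _) _ => s5 [c5 D5]; rewrite /answer c5.
case: d4 => [[-> [X eX DX]]|h|h]; [constructor 1|constructor 2|constructor 3] => //.
by split=> //; exists X => // w wn; rewrite D5 // DX.
Qed.

End Specs.

(** * Encoded graphs *)

Lemma size_flatten_iota (f : nat -> seq nat) i :
  size (flatten (map f (iota 0 i))) = \sum_(l < i) size (f l).
Proof.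
elim: i => [|i IH]; first by rewrite big_ord0.
by rewrite -[i.+1]addn1 iotaD map_cat flatten_cat size_cat IH addn1 big_ord_recr /= cats0.
Qed.

Lemma nth_flatten_iota (f : nat -> seq nat) n i j : i < n -> j < size (f i) ->
  nth 0 (flatten (map f (iota 0 n))) (\sum_(l < i) size (f l) + j) = nth 0 (f i) j.
Proof.
move=> ltin jf; have -> : n = i + (n - i.+1).+1 by lia.
rewrite iotaD map_cat flatten_cat nth_cat size_flatten_iota ltnNge leq_addr addKn /=.
by rewrite nth_cat jf.
Qed.

(** From n and m in the first two input cells, register 4 receives the input length 2m + n + 2; the
    further bases follow in steps of n + 1. Register 3, the base of the input, stays 0. *)
Definition prologue : seq instr :=
  [:: IConst 2 1; ILoad 1 0; ILoad 4 2; IAdd 4 4 4; IAdd 4 4 1; IAdd 1 1 2;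
      IAdd 4 4 2; IAdd 4 4 2; IAdd 5 4 1; IAdd 6 5 1; IAdd 7 6 1; IAdd 8 7 1;
      IAdd 9 8 1].

Definition program : seq instr := prologue ++ compile (size prologue) main.

Lemma code_at_suffix pre cs : code_at (pre ++ cs) (size pre) cs.
Proof. by move=> i _; rewrite nth_cat ltnNge leq_addr addKn. Qed.

Lemma nth_end pre cs : nth IHalt (pre ++ cs) (size pre + size cs) = IHalt.
Proof. by rewrite nth_default // size_cat. Qed.

Lemma reaches_reg B prog t x p R M i r v : reaches B prog t x (State p R M) ->
  nth IHalt prog p = i ->
  match i with
  | IConst r' v' => r' = r /\ v' = v
  | IAdd r' a b => r' = r /\ R a + R b = v
  | ILoad r' a => r' = r /\ M (R a) = v
  | _ => False
  end ->
  v <= B -> reaches B prog t.+1 x (State p.+1 (upd R r v) M).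
Proof.
move=> re ip st vB; rewrite -addn1; apply: (reaches_trans re).
apply: reaches_step; [exact: reaches_last re|exact: bounded_upd (reaches_last re) vB _|].
by case: i ip st => // [? ?|? ? ?|? ?] ip; rewrite /step /cur_instr /= ip => -[-> ->].
Qed.

(** * Transfer between graphs on ordinals and neighbour lists *)

Section Bridge.

Variables (n : nat) (e : rel 'I_n) (adj : 'I_n -> seq 'I_n).
Hypotheses (He : simple_graph e) (Ha : adj_lists e adj).

Definition nbrs (x : nat) : seq nat :=
  if insub x is Some i then map val (adj i) else [::].

Lemma nbrs_ord (i : 'I_n) : nbrs i = map val (adj i).
Proof. by rewrite /nbrs valK. Qed.

Lemma mem_nbrs (i j : 'I_n) : (val j \in nbrs i) = e i j.
Proof. by rewrite nbrs_ord mem_map; [case: (Ha i)|exact: val_inj]. Qed.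

Lemma nbrsP x y : y \in nbrs x -> exists i j : 'I_n, [/\ x = i, y = j & e i j].
Proof.
rewrite /nbrs; case: insubP => // i _ <- /mapP[j ji ->].
by exists i, j; split=> //; case: (Ha i) => _ <-.
Qed.

Lemma nbrs_adjacency : adjacency n nbrs.
Proof.
case: He => sym irr; split.
- by move=> x y /nbrsP[i [j [_ -> _]]].
- by move=> x y; apply/idP/idP => /nbrsP[i [j [-> -> ij]]]; rewrite mem_nbrs sym.
- by move=> x; apply/negP => /nbrsP[i [j [-> /val_inj <-]]]; rewrite irr.
- move=> x; rewrite /nbrs; case: insub => // i.
  by rewrite map_inj_uniq; [case: (Ha i)|exact: val_inj].
Qed.

(** Each edge is counted once with its smaller end first; exchanging the two summations gives the
    count from the larger end. *)
Lemma handshake : \sum_(w < n) size (nbrs w) = num_edges e + num_edges e.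
Proof.
case: He => sym irr.
have dE (i : 'I_n) : size (nbrs i) = \sum_(j < n) e i j.
  rewrite nbrs_ord size_map; have [un me] := Ha i.
  by rewrite -(card_uniqP un) -sum1_card big_mkcond /=; apply: eq_bigr => j _; rewrite me; case: e.
have mE : num_edges e = \sum_(i < n) \sum_(j < n) ((i < j) && e i j).
  rewrite /num_edges -sum1_card pair_big /= big_mkcond /=; apply: eq_bigr => p _.
  by rewrite inE; case: ifP.
rewrite (eq_bigr _ (fun i _ => dE i)) {1}mE mE [X in _ = _ + X]exchange_big -big_split /=.
apply: eq_bigr => i _; rewrite -big_split /=; apply: eq_bigr => j _.
rewrite [e j i]sym; case: (ltngtP i j) => [_|_|/val_inj->]; rewrite ?irr //=.
by rewrite addn0.
Qed.

Lemma dcount_card (D : {set 'I_n}) (X : pred nat) (v : 'I_n) :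
  (forall u : 'I_n, (u \in D) = X u) ->
  #|[set u in D | dominates e u v]| = dcount nbrs X v.
Proof.
case: He => sym irr DX; have [un me] := Ha v.
have -> : dcount nbrs X v = (v \in D) + count (mem D) (adj v).
  by rewrite /dcount DX nbrs_ord count_map; congr (_ + _); apply: eq_count => u /=; rewrite DX.
rewrite -size_filter -(card_uniqP (filter_uniq (mem D) un)).
rewrite -[#|filter _ _|]cardsE (cardsD1 v) !inE /dominates eqxx andbT; congr (_ + _).
apply: eq_card => u; rewrite !inE mem_filter me [e u v]sym /=.
by case: eqP => [->|_] //=; rewrite irr andbF.
Qed.

Lemma ed_efficient (D : {set 'I_n}) (X : pred nat) :
  (forall u : 'I_n, (u \in D) = X u) -> ed n nbrs X <-> efficient_dominating e D.
Proof.
move=> DX; split=> H => [v|x xn]; first by rewrite (dcount_card _ DX) H.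
by rewrite -(H (Ordinal xn)) (dcount_card _ DX).
Qed.

Lemma has2P2_induced : has2P2 nbrs -> ~ twoP2_free e.
Proof.
case=> _ [_ [_ [_ [/nbrsP[a [b [-> -> ab]]] /nbrsP[c [d [-> -> cd]]]]]]].
rewrite !mem_nbrs => -[ac ad bc bd]; apply; exists a, b, c, d; split=> //.
(* Identifying ends of the two edges would turn one of the edges into an excluded adjacency. *)
case: He => sym irr; split=> //; split; apply/eqP => E.
- by rewrite E cd in ad.
- by rewrite E [e d c]sym cd in ac.
- by rewrite -E ab in ac.
- by rewrite -E ab in ad.
Qed.

Lemma answer_correct M : answer n nbrs M -> correct_output e M.
Proof.
case=> [[M0 [X eX MX]]|[M1 no]|[M2 h]].
- left; split=> //; apply/(ed_efficient (X := X)) => // u.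
  by rewrite inE MX; [case: (X u)|exact: ltn_ord].
- right; left; split=> // -[D].
  (* The set is extended to all naturals by false outside the vertex range. *)
  move/(@ed_efficient D (fun x => if insub x is Some u then u \in D else false)) => H.
  by apply: no (H _) => u; rewrite valK.
- by right; right; split=> //; apply: has2P2_induced.
Qed.

(** * Memory layout and the final bounds *)

Let m := num_edges e.
(** The input length: two header cells, n length fields and 2m list entries, associated in the order
    in which [prologue] adds them. *)
Let L := m + m + n + 1 + 1.
Let B := 300 * (n + m + 1).
Let input := encode e adj.

Definition base (k : nat) : nat := if k == 0 then 0 else L + k.-1 * (n + 1).

Definition start_store : store :=
  Store (fun=> 0) (fun k i => if k == 0 then nth 0 input i else 0).

Lemma input_blocks : input =
  n :: m :: flatten [seq size (nbrs i) :: nbrs i | i <- iota 0 n].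
Proof.
rewrite /input /encode -val_enum_ord -map_comp; congr [:: _, _ & flatten _].
by apply: eq_map => i /=; rewrite nbrs_ord size_map.
Qed.

Lemma size_input : size input = L.
Proof.
rewrite input_blocks /= size_flatten_iota /= (eq_bigr (fun w : 'I_n => size (nbrs w) + 1)) => [|w _].
  by rewrite big_split /= sum_nat_const card_ord handshake -/m /L; lia.
by rewrite addn1.
Qed.

Lemma nth_input i j : i < n -> j < (size (nbrs i)).+1 ->
  nth 0 input (pos nbrs i + j) = nth 0 (size (nbrs i) :: nbrs i) j.
Proof.
move=> lin jl; rewrite input_blocks /pos -addnA /=.
exact: (@nth_flatten_iota (fun i => size (nbrs i) :: nbrs i)).
Qed.

Lemma start_initial : initial n nbrs start_store.
Proof.
split=> // [[]//|i lin].
have -> : ar start_store aIn = nth 0 input by [].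
split=> [|j jl]; first by rewrite -[pos nbrs i]addn0 nth_input.
by rewrite addSnnS nth_input.
Qed.

Lemma pos_end : L = pos nbrs n.
Proof.
rewrite /L /pos; under eq_bigr do rewrite -addn1.
rewrite big_split /= sum_nat_const card_ord handshake -/m; lia.
Qed.

Lemma arrays_disjoint k k' i i' : k < narrays -> k' < narrays ->
  i < sizes n L k -> i' < sizes n L k' -> base k + i = base k' + i' -> k = k' /\ i = i'.
Proof.
move=> _ _; rewrite /base /sizes; case: k k' => [|k] [|k'] //=; try lia.
move=> ik ik' E; have {}E : k * (n + 1) + i = k' * (n + 1) + i' by lia.
(* Offsets are at most [n], so division by the array length recovers the array number. *)
have : (k * (n + 1) + i) %/ (n + 1) = k by rewrite divnMDl ?divn_small; lia.
have : (k' * (n + 1) + i') %/ (n + 1) = k' by rewrite divnMDl ?divn_small; lia.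
by rewrite E => -> kk; subst; split=> //; lia.
Qed.

Lemma arrays_fit k i : k < narrays -> i < sizes n L k -> base k + i <= B.
Proof.
rewrite /base /sizes /narrays /L /B; case: k => [|k] /= k7 ik; first lia.
have : k * (n + 1) <= 6 * (n + 1) by rewrite leq_mul2r; lia.
lia.
Qed.

Lemma input_bounded a : nth 0 input a <= B.
Proof.
rewrite input_blocks; have nB : n <= B by rewrite /B; lia.
case: a => [|[|a]] /=; rewrite ?nB //; first by rewrite /B; lia.
case: (ltnP a (size (flatten [seq size (nbrs i) :: nbrs i | i <- iota 0 n]))) => ha; last first.
  by rewrite nth_default.
have /flattenP[s /mapP[i _ ->]] := mem_nth 0 ha.
rewrite inE => /orP[/eqP->|].
  by apply: leq_trans (degree_le nbrs_adjacency i) nB.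
by case: nbrs_adjacency => lt _ _ _ /lt/ltnW ai; apply: leq_trans ai nB.
Qed.

Lemma prologue_reaches cs : exists x,
  [/\ reaches B (prologue ++ cs) (size prologue) (init_state input) x,
      ram_pc x = size prologue & represents (sizes n L) base x start_store].
Proof.
have b0 : bounded B (init_state input) by split=> // a; apply: input_bounded.
have vB v : v <= L + 6 * (n + 1) -> v <= B by rewrite /L /B; lia.
have v1 : 1 <= B by apply: vB; lia.
have v2 : n <= B by apply: vB; lia.
have v3 : m <= B by apply: vB; lia.
have v4 : m + m <= B by apply: vB; lia.
have v5 : m + m + n <= B by apply: vB; lia.
have v6 : n + 1 <= B by apply: vB; lia.
have v7 : m + m + n + 1 <= B by apply: vB; lia.
have v8 : L <= B by apply: vB; lia.
have v9 : L + 1 * (n + 1) <= B by apply: vB; lia.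
have v10 : L + 2 * (n + 1) <= B by apply: vB; lia.
have v11 : L + 3 * (n + 1) <= B by apply: vB; lia.
have v12 : L + 4 * (n + 1) <= B by apply: vB; lia.
have v13 : L + 5 * (n + 1) <= B by apply: vB; lia.
have E0 : L + (n + 1) = L + 1 * (n + 1) by lia.
have E k : L + k * (n + 1) + (n + 1) = L + k.+1 * (n + 1) by lia.
have r0 := reaches_refl (prologue ++ cs) b0.
have {r0} r1 := reaches_reg (r := 2) (v := 1) r0 erefl (conj erefl erefl) v1.
have {r1} r2 := reaches_reg (r := 1) (v := n) r1 erefl (conj erefl erefl) v2.
have {r2} r3 := reaches_reg (r := 4) (v := m) r2 erefl (conj erefl erefl) v3.
have {r3} r4 := reaches_reg (r := 4) (v := m + m) r3 erefl (conj erefl erefl) v4.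
have {r4} r5 := reaches_reg (r := 4) (v := m + m + n) r4 erefl (conj erefl erefl) v5.
have {r5} r6 := reaches_reg (r := 1) (v := n + 1) r5 erefl (conj erefl erefl) v6.
have {r6} r7 := reaches_reg (r := 4) (v := m + m + n + 1) r6 erefl (conj erefl erefl) v7.
have {r7} r8 := reaches_reg (r := 4) (v := L) r7 erefl (conj erefl erefl) v8.
have {r8} r9 := reaches_reg (r := 5) (v := L + 1 * (n + 1)) r8 erefl (conj erefl E0) v9.
have {r9} r10 := reaches_reg (r := 6) (v := L + 2 * (n + 1)) r9 erefl (conj erefl (E 1)) v10.
have {r10} r11 := reaches_reg (r := 7) (v := L + 3 * (n + 1)) r10 erefl (conj erefl (E 2)) v11.
have {r11} r12 := reaches_reg (r := 8) (v := L + 4 * (n + 1)) r11 erefl (conj erefl (E 3)) v12.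
have {r12} r13 := reaches_reg (r := 9) (v := L + 5 * (n + 1)) r12 erefl (conj erefl (E 4)) v13.
eexists; split; [exact: r13|by []|split=> //].
- rewrite /narrays /base_reg /base => -[|[|[|[|[|[|[|k]]]]]]] //= _; rewrite /upd /=; lia.
- by move=> r; rewrite /upd /user_reg /narrays /=; repeat (case: eqP => [|_]; first lia).
- case=> [|k] i //= k7; rewrite /sizes /base /= => ik.
  (* Beyond the input the memory reads the default 0, so the work arrays start out zeroed. *)
  by rewrite nth_default // size_input; lia.
Qed.

Lemma program_runs : exists k, [/\ k <= B, halted program (run program k (init_state input)),
    correct_output e (ram_mem (run program k (init_state input)))
  & forall t, t <= k -> bounded B (run program t (init_state input))].
Proof.
have [x [rx px repx]] := prologue_reaches (compile (size prologue) main).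
have LB : L <= B by rewrite /L /B; lia.
have nB : n.+2 <= B by rewrite /B; lia.
have nL : n.+2 <= L by rewrite /L; lia.
have [sa ti ans] := main_spec nbrs_adjacency LB nB nL pos_end start_initial.
have [y [ry py repy]] := simulation arrays_disjoint arrays_fit main_well_formed
  (@code_at_suffix prologue _) px repx (reaches_last rx) sa.
have [rE rb] := reaches_trans rx ry.
exists (size prologue + time main start_store); rewrite -/program in rE rb *; split=> //.
(* The degree sum is 2m, so 13 + 130 (n + 2m + 1) steps suffice, within the bound with constant
   300. *)
- move: ti; rewrite handshake -/m /B (_ : size prologue = 13) //; lia.
(* The run ends just past the last instruction, where the default [IHalt] applies. *)
- by rewrite rE /halted /cur_instr py nth_end.
- rewrite rE; apply: answer_correct; case: repy => _ _ _ _ mem.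
  have memE w : w <= n -> ram_mem y w = ar (eval main start_store) aIn w.
    by move=> wn; rewrite -(mem aIn w) // /sizes /=; lia.
  move: ans; rewrite /answer memE // => -[[a0 [X eX DX]]|h|h].
  + by constructor 1; split=> //; exists X => // w wn; rewrite memE ?DX.
  + by constructor 2.
  + by constructor 3.
Qed.

End Bridge.

(* There is a RAM program and a constant c such that, on every finite simple
   graph given by adjacency lists (arbitrary input, 2P2-freeness not assumed),
   the program halts within c*(n+m+1) steps, uses only words of value at most
   c*(n+m+1) (word-RAM), and outputs a correct answer: an e.d., or "no e.d.",
   or "the input is not 2P2-free" -- each claim being true. *)
Theorem theorem1 :
  exists (prog : seq instr) (c : nat),
    forall (n : nat) (e : rel 'I_n) (adj : 'I_n -> seq 'I_n),
      simple_graph e -> adj_lists e adj ->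
      let N := (c * (n + num_edges e + 1))%N in
      exists k : nat,
        (k <= N)%N /\
        halted prog (run prog k (init_state (encode e adj))) /\
        correct_output e (ram_mem (run prog k (init_state (encode e adj)))) /\
        (forall t, (t <= k)%N ->
           forall a, (ram_reg (run prog t (init_state (encode e adj))) a <= N)%N /\
                     (ram_mem (run prog t (init_state (encode e adj))) a <= N)%N).
Proof.
exists program, 300 => n e adj He Ha N.
have [k [kN hk ok bk]] := program_runs He Ha.
by exists k; do 3 split=> //; move=> t /bk[b1 b2] a.
Qed.
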